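(* Let $r\ge 1$, $\kappa\in C^{d}(\Omega)$, $\frac{\partial\kappa}{\partial u}\in C^{2r}(\Omega)$ and $f\in C^{d}[a,b]$. Let $\varphi$ be the unique solution of $x-\mathcal K(x)=f$ and assume that $1$ is not an eigenvalue of $\mathcal K'(\varphi)$. For $n\ge n_1$ and $m=np\ge m_1$, let $z_n^M$ be the unique solution in $B(\varphi,\delta_0)$ of the discrete modified projection equation $x_n-\tilde{\mathcal K}_n^M(x_n)=f$. Then $$\|z_n^M-\varphi\|_\infty=O\left(\max\{\tilde h^{d},h^{3r}\}\right),$$ that is, there is a constant $C$ independent of $n$ and $p$ such that $\|z_n^M-\varphi\|_\infty\le C\max\{\tilde h^{d},h^{3r}\}$ for all $n\ge n_1$ and all $p\ge1$ with $m=np\ge m_1$.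
   Context: Partitions and quadrature. Fix reals $a<b$ and an integer $r\ge1$. Fix a basic quadrature rule $\int_0^1 g(t)\,dt\approx\sum_{i=1}^\rho w_i g(\mu_i)$ with real weights $w_i$ and nodes $\mu_i\in[0,1]$, exact for polynomials of degree $\le 2r-1$. For $n,p\in\mathbb N$ let $m=np$, $h=(b-a)/n$, $\tilde h=(b-a)/m$, $t_k=a+kh$ ($0\le k\le n$), $s_j=a+j\tilde h$ ($0\le j\le m$), $\zeta_i^j=s_{j-1}+\mu_i\tilde h$ ($1\le i\le\rho$, $1\le j\le m$). It is assumed that there are an integer $d\ge 2r$ and a constant $C_1$ such that for every $m$ and every $g\in C^d[a,b]$, $\left|\int_a^b g(t)\,dt-\tilde h\sum_{j=1}^m\sum_{i=1}^\rho w_i g(\zeta_i^j)\right|\le C_1\|g^{(d)}\|_\infty\tilde h^d$. Spaces and interpolation. $E_n=\prod_{k=1}^n C([t_{k-1},t_k])$ with the sup norm $\|\cdot\|_\infty$: functions continuous on each closed subinterval, with possibly two one-sided values at interior breakpoints; $C[a,b]\subset E_n$. For $v\in E_n$ and $(k-1)p<j\le kp$, $v(\zeta_i^j)$ means the value of the $k$-th component of $v$. $\mathcal X_n\subset E_n$ is the space of piecewise polynomials of degree $\le r-1$ on the partition $\{t_k\}$. Let $0<q_1<\dots<q_r<1$ be the zeros of the Legendre polynomial of degree $r$ shifted to $[0,1]$, $\tau_i^k=t_{k-1}+q_ih$; $Q_n:E_n\to\mathcal X_n$ is defined by $(Q_nx)(\tau_i^k)=x(\tau_i^k)$ for all $i,k$.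 Urysohn equation. $\Omega=[a,b]\times[a,b]\times\mathbb R$, $\kappa(s,t,u)$ is a continuous real function on $\Omega$ with $\partial^2\kappa/\partial u^2\in C(\Omega)$, $\mathcal K(x)(s)=\int_a^b\kappa(s,t,x(t))\,dt$ on $L^\infty[a,b]$, $f\in C[a,b]$, and $x-\mathcal K(x)=f$ has a unique solution $\varphi$. $\mathcal K'(\varphi)v(s)=\int_a^b\frac{\partial\kappa}{\partial u}(s,t,\varphi(t))v(t)\,dt$; $1$ is not an eigenvalue of $\mathcal K'(\varphi)$. Nyström operator: $\mathcal K_m(x)(s)=\tilde h\sum_{j=1}^m\sum_{i=1}^\rho w_i\,\kappa(s,\zeta_i^j,x(\zeta_i^j))$ for $x\in E_n$. Discrete modified projection operator on $E_n$: $\tilde{\mathcal K}_n^M(x)=Q_n\mathcal K_m(x)+\mathcal K_m(Q_nx)-Q_n\mathcal K_m(Q_nx)$. $B(\varphi,\delta)=\{x\in E_n:\|x-\varphi\|_\infty\le\delta\}$. Standing constants. $\delta_0>0$ and positive integers $n_1,m_1$ are fixed (such constants exist) so that for all $n\ge n_1$ and $m=np\ge m_1$: the Nyström equation $x-\mathcal K_m(x)=f$ has a unique solution $\varphi_m$ in $B(\varphi,\delta_0)$; $Q_n\varphi,Q_n\varphi_m\in B(\varphi,\delta_0)$; and $x-\tilde{\mathcal K}_n^M(x)=f$ has a unique solution $z_n^M$ in $B(\varphi,\delta_0)$. *)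

(* Defs.v *)
From HB Require Import structures.
From mathcomp Require Import all_boot all_order all_algebra.
From mathcomp Require Import all_classical all_reals all_analysis.

Set Implicit Arguments.
Unset Strict Implicit.
Unset Printing Implicit Defensive.

Import Order.TTheory GRing.Theory Num.Theory.
Import numFieldNormedType.Exports.

Local Open Scope classical_set_scope.
Local Open Scope ring_scope.

Section Smoothness.
Context {R : realType}.

(* Derivatives relative to a set [A]: one-sided at the endpoints of an interval. *)
Definition quot (g : R -> R) (x y : R) : R := (g y - g x) / (y - x).

Definition derivable_on (A : set R) (g : R -> R) (x : R) : Prop :=
  cvg (quot g x y @[y --> within A x^']).

Definition derive_on (A : set R) (g : R -> R) (x : R) : R :=
  lim (quot g x y @[y --> within A x^']).

Variables a b : R.

Fixpoint C_itv (k : nat) (g : R -> R) : Prop :=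
  {within `[a, b], continuous g} /\
  (if k is k'.+1 then
     {in `[a, b], forall x, derivable_on `[a, b] g x} /\
     C_itv k' (derive_on `[a, b] g)
   else True).

Definition derive_itv (k : nat) (g : R -> R) : R -> R :=
  iter k (derive_on `[a, b]) g.

Definition supnorm_itv (g : R -> R) : R := sup [set `|g t| | t in `[a, b]].

Definition Omega : set (R * R * R) :=
  [set z | z.1.1 \in `[a, b] /\ z.1.2 \in `[a, b]].

Implicit Type F : R -> R -> R -> R.

Definition continuous_Omega F : Prop :=
  {within Omega, continuous (fun z => F z.1.1 z.1.2 z.2)}.

Definition partial_s F : R -> R -> R -> R :=
  fun s t u => derive_on `[a, b] (fun s' => F s' t u) s.
Definition partial_t F : R -> R -> R -> R :=
  fun s t u => derive_on `[a, b] (fun t' => F s t' u) t.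
Definition partial_u F : R -> R -> R -> R :=
  fun s t u => derive1 (F s t) u.

Definition has_partial_s F : Prop := forall s t u, Omega (s, t, u) ->
  derivable_on `[a, b] (fun s' => F s' t u) s.
Definition has_partial_t F : Prop := forall s t u, Omega (s, t, u) ->
  derivable_on `[a, b] (fun t' => F s t' u) t.
Definition has_partial_u F : Prop := forall s t u, Omega (s, t, u) ->
  derivable (F s t) u 1.

Fixpoint C_Omega (k : nat) F : Prop :=
  continuous_Omega F /\
  (if k is k'.+1 then
     [/\ has_partial_s F, has_partial_t F & has_partial_u F] /\
     [/\ C_Omega k' (partial_s F), C_Omega k' (partial_t F)
       & C_Omega k' (partial_u F)]
   else True).

End Smoothness.

Section Quadrature.
Context {R : realType}.

Definition quad_exact (rho : nat) (w mu : 'I_rho -> R) (deg : nat) : Prop :=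
  forall P : {poly R}, (size P <= deg.+1)%N ->
    \int[lebesgue_measure]_(t in `[0, 1]) P.[t] = \sum_(i < rho) w i * P.[mu i].

Definition mesh (a b : R) (n : nat) : R := (b - a) / n%:R.

Definition grid (a b : R) (n k : nat) : R := a + k%:R * mesh a b n.

(* The subinterval index is 0-based: [quad_node mu a b m j i] lies in
   [s_j, s_(j+1)] for j < m, and similarly below. *)
Definition quad_node (rho : nat) (mu : 'I_rho -> R) (a b : R) (m j : nat)
    (i : 'I_rho) : R :=
  grid a b m j + mu i * mesh a b m.

Definition composite (rho : nat) (w mu : 'I_rho -> R) (a b : R) (m : nat)
    (g : R -> R) : R :=
  mesh a b m * \sum_(j < m) \sum_(i < rho) w i * g (quad_node mu a b m j i).

(* Rodrigues' formula on [-1, 1], then the shift to [0, 1]. *)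
Definition legendre (r : nat) : {poly R} :=
  (2 ^+ r * r`!%:R)^-1 *: (('X^2 - 1) ^+ r)^`(r).

Definition shifted_legendre (r : nat) : {poly R} :=
  legendre r \Po (2 *: 'X - 1).

(* r increasing zeros of a polynomial of degree r are all of its zeros. *)
Definition legendre_zeros (r : nat) (q : 'I_r -> R) : Prop :=
  [/\ forall i, 0 < q i < 1,
      forall i j : 'I_r, (i < j)%N -> q i < q j
    & forall i, root (shifted_legendre r) (q i)].

End Quadrature.

Section PiecewiseContinuous.
Context {R : realType}.

(* [x k] is the component of [x] on [t_k, t_(k+1)], for 0 <= k < n; the values
   of [x k] outside that interval, and [x k] for k >= n, are irrelevant. *)
Definition pwfun : Type := nat -> R -> R.

Variables a b : R.

Definition piece (n k : nat) : interval R :=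
  `[grid a b n k, grid a b n k.+1].

Definition in_E (n : nat) (x : pwfun) : Prop :=
  forall k, (k < n)%N -> {within [set` piece n k], continuous (x k)}.

Definition eq_E (n : nat) (x y : pwfun) : Prop :=
  forall k, (k < n)%N -> {in piece n k, x k =1 y k}.

Definition norm_E (n : nat) (x : pwfun) : R :=
  sup [set c | exists k t, [/\ (k < n)%N, t \in piece n k & c = `|x k t|]].

Definition emb (g : R -> R) : pwfun := fun=> g.

Definition ball_E (n : nat) (phi : R -> R) (delta : R) (x : pwfun) : Prop :=
  in_E n x /\ norm_E n (fun k t => x k t - phi t) <= delta.

Definition unique_in_ball (n : nat) (phi : R -> R) (delta : R)
    (sol : pwfun -> Prop) (x : pwfun) : Prop :=
  [/\ ball_E n phi delta x, sol x
    & forall y, ball_E n phi delta y -> sol y -> eq_E n y x].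

Variables (r : nat) (q : 'I_r -> R).

Definition coll_node (n k : nat) (i : 'I_r) : R :=
  grid a b n k + q i * mesh a b n.

(* Unique, and never the default 0, as soon as the nodes are distinct. *)
Definition interp (n : nat) (x : pwfun) (k : nat) : {poly R} :=
  xget 0 [set P : {poly R} | (size P <= r)%N /\
            forall i, P.[coll_node n k i] = x k (coll_node n k i)].

Definition Qn (n : nat) (x : pwfun) : pwfun :=
  fun k t => (interp n x k).[t].

End PiecewiseContinuous.

Arguments pwfun R : clear implicits.

Section Urysohn.
Context {R : realType}.
Variables a b : R.

Definition ae_itv (P : R -> Prop) : Prop :=
  {ae lebesgue_measure, forall t, t \in `[a, b] -> P t}.

Definition Linfty (x : R -> R) : Prop :=
  measurable_fun `[a, b] x /\ exists M, ae_itv (fun t => `|x t| <= M).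

Definition urysohn (kappa : R -> R -> R -> R) (x : R -> R) : R -> R :=
  fun s => \int[lebesgue_measure]_(t in `[a, b]) kappa s t (x t).

Definition urysohn_solution (kappa : R -> R -> R -> R) (f x : R -> R) : Prop :=
  Linfty x /\ ae_itv (fun s => x s - urysohn kappa x s = f s).

(* The unique solution in L^oo[a, b], taken with its continuous representative. *)
Definition urysohn_unique (kappa : R -> R -> R -> R) (f phi : R -> R) : Prop :=
  [/\ {within `[a, b], continuous phi}, urysohn_solution kappa f phi
    & forall x, urysohn_solution kappa f x -> ae_itv (fun t => x t = phi t)].

Definition urysohn_deriv (kappa : R -> R -> R -> R) (phi v : R -> R) : R -> R :=
  fun s => \int[lebesgue_measure]_(t in `[a, b])
             (partial_u kappa s t (phi t) * v t).

Definition eigenvalue_Linfty (T : (R -> R) -> (R -> R)) (lambda : R) : Prop :=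
  exists v, [/\ Linfty v, ~ ae_itv (fun t => v t = 0)
              & ae_itv (fun s => T v s = lambda * v s)].

Variables (rho : nat) (w mu : 'I_rho -> R) (r : nat) (q : 'I_r -> R).
Variables (kappa : R -> R -> R -> R) (f : R -> R).

(* For j < n * p, the j-th fine subinterval lies in the (j %/ p)-th coarse one. *)
Definition nystrom (n p : nat) (x : pwfun R) : R -> R :=
  fun s => mesh a b (n * p) * \sum_(j < n * p) \sum_(i < rho)
    w i * kappa s (quad_node mu a b (n * p) j i)
                  (x (j %/ p)%N (quad_node mu a b (n * p) j i)).

Definition dmp (n p : nat) (x : pwfun R) : pwfun R :=
  let Q := Qn a b q n in
  let K y := emb (nystrom n p y) in
  fun k s => Q (K x) k s + K (Q x) k s - Q (K (Q x)) k s.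

Definition nystrom_eq (n p : nat) (x : pwfun R) : Prop :=
  eq_E a b n (fun k s => x k s - nystrom n p x s) (emb f).

Definition dmp_eq (n p : nat) (x : pwfun R) : Prop :=
  eq_E a b n (fun k s => x k s - dmp n p x k s) (emb f).

Definition standing_constants (phi : R -> R) (delta0 : R) (n1 m1 : nat) : Prop :=
  [/\ 0 < delta0, (0 < n1)%N, (0 < m1)%N
    & forall n p : nat, (n1 <= n)%N -> (m1 <= n * p)%N ->
      [/\ exists2 phim, unique_in_ball a b n phi delta0 (nystrom_eq n p) phim
                      & ball_E a b n phi delta0 (Qn a b q n phim),
          ball_E a b n phi delta0 (Qn a b q n (emb phi))
        & exists z, unique_in_ball a b n phi delta0 (dmp_eq n p) z]].

End Urysohn.

(* Main.v *)
Require Import Defs.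
From HB Require Import structures.
From mathcomp Require Import all_boot all_order all_algebra.
From mathcomp Require Import all_classical all_reals all_analysis.
From mathcomp Require Import measurable_realfun.
From mathcomp Require Import ring lra zify.

Import Order.TTheory GRing.Theory Num.Theory.
Import numFieldNormedType.Exports.

Local Open Scope classical_set_scope.
Local Open Scope ring_scope.

(* Write [N] for the Nystrom operator, [h] for the coarse mesh, [e = z - phi] and
   [Q] for the interpolation. The equation for [z] reads
   [z - N z - f = (I - Q) (N (Q z) - N z)].

   Size of the right-hand side. At a point, [I - Q] is a finite combination [A] of
   point evaluations in [s] which is [O(h^r)] on C^r functions, and it commutes with
   [N] and with [d/du]. Replacing [z] by [phi] costs [O(h^r |e|)] by the mean value
   theorem for [A kappa]; for [phi], a Taylor expansion in [u] leaves the discrete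
   integral of [A kappa_u(., t, phi t) (Q phi - phi)(t)] up to [O(h^(3 r))]. On each
   coarse piece, expanding both factors in Taylor polynomials, the products of total
   degree less than [2 r] integrate to zero (exactness of the rule, and orthogonality
   of the Legendre polynomial to lower degrees), which gives [O(h^(3 r))] again.

   Hence [e - N'(phi) e = O(h^(3 r) + h~^d + h^r |e| + |e|^2)], and two facts finish:
   [e -> 0], and [|v| <= C |v - N'(phi) v|] for [n] large. Both follow from one
   compactness argument: a bounded sequence with [x_j - N x_j - f -> 0] has a uniform
   limit point solving the continuous equation; here uniqueness of [phi], resp. the
   absence of the eigenvalue 1, identifies the limit. For the finitely many small [n]
   the bound is trivial, since [h] is then bounded below. *)

Set Implicit Arguments.
Unset Strict Implicit.
Unset Printing Implicit Defensive.

(** * Interpolation and Legendre polynomials *)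

(** The exponent [3 r] is one factor [h^r] from the outer [I - Q], acting in [s], times [h^(2 r)]
    from the inner [Q z - z], acting in [t]. The obstacle is uniformity: the coefficient paired with
    [Q phi - phi] depends on [n], on the piece and on [s], yet superconvergence needs a common bound
    on [r] of its derivatives in [t]. The outer interpolation error is therefore divided by [h^r]
    and stored as a finite list of weights and points; bounds are then proved for the whole family
    of such lists at once. This spends [r] derivatives of [kappa_u] in [s] and [r] more in [t],
    which accounts for the [2 r] asked of it. Nothing restricts [p]: discrete integrals are bounded
    through the sum of the [|w i|] alone, orthogonality is exact for the composite rule with every
    [p], and the fine mesh tends to 0 as soon as [n] tends to infinity. The compactness arguments
    give neither a rate nor explicit constants. The rate appears only in the final inequality, whose
    terms in [|e|] are absorbed by the left-hand side. *)

Section Lagrange.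
Context {R : realType} {r : nat} (q : 'I_r -> R).

Definition nodal : {poly R} := \prod_(i < r) ('X - (q i)%:P).

Definition lag (i : 'I_r) : {poly R} :=
  \prod_(j < r | j != i) ((q i - q j)^-1 *: ('X - (q j)%:P)).

(* The interpolation error [X^i - Q X^i] on the reference interval [[0, 1]]. *)
Definition mono_err (i : nat) : {poly R} := 'X^i - \sum_a (q a ^+ i) *: lag a.

Lemma size_nodal : size nodal = r.+1.
Proof. by rewrite /nodal -big_enum size_prod_XsubC size_enum_ord. Qed.

Hypothesis q_inj : injective q.

Lemma lag_node i j : (lag i).[q j] = (i == j)%:R.
Proof.
rewrite /lag horner_prod; have [<-|ij] := eqVneq i j.
  rewrite big1 // => k ki; rewrite !hornerE mulVf // subr_eq0.
  by apply: contra ki => /eqP /q_inj ->.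
rewrite (bigD1 j) /=; last by rewrite eq_sym.
by rewrite !hornerE subrr mulr0 mul0r.
Qed.

Lemma size_lag i : (size (lag i) <= r)%N.
Proof.
apply: leq_trans (size_poly_prod_leq _ _) _.
have E : (\sum_(j < r | j != i) size ((q i - q j)^-1 *: ('X - (q j)%:P)) <=
   \sum_(j < r | j != i) 2)%N.
  by apply: leq_sum => j _; apply: leq_trans (size_scale_leq _ _) _; rewrite size_XsubC.
move: E; rewrite sum_nat_const.
have -> : #|[pred j | j != i]| = r.-1.
  by have := cardC1 i; rewrite card_ord => <-; apply: eq_card => j; rewrite !inE.
have := ltn_ord i; set X := bigop _ _ _. lia.
Qed.

(** Distinct roots factor out. The subtraction is truncated: when [size P <= r] the cofactor has
    size 0, and this is how every uniqueness of interpolation below is obtained. *)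
Lemma nodal_dvd (P : {poly R}) : (forall i, root P (q i)) ->
  exists2 S, P = S * nodal & (size S <= size P - r)%N.
Proof.
move=> hP; pose rs := map q (enum 'I_r).
have urs : uniq_roots rs by rewrite uniq_rootsE map_inj_uniq ?enum_uniq.
have ars : all (root P) rs by apply/allP => x /mapP[i _ ->].
have [S PS] := uniq_roots_prod_XsubC ars urs.
exists S; first by rewrite PS big_map big_enum.
have [->|S0] := eqVneq S 0; first by rewrite size_poly0.
by rewrite PS size_Mmonic ?monic_prod_XsubC // size_prod_XsubC size_map size_enum_ord addnS /= addnK.
Qed.

Lemma lag_exact (P : {poly R}) : (size P <= r)%N ->
  P = \sum_a P.[q a] *: lag a.
Proof.
move=> sP; apply/eqP; rewrite -subr_eq0; apply/eqP.
set D := _ - _.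
have sD : (size D <= r)%N.
  apply: leq_trans (size_polyD _ _) _; rewrite geq_max sP size_polyN.
  apply: (big_ind (fun p : {poly R} => (size p <= r)%N)).
  - by rewrite size_poly0.
  - by move=> x y hx hy; apply: leq_trans (size_polyD _ _) _; rewrite geq_max hx.
  - by move=> a _; apply: leq_trans (size_scale_leq _ _) (size_lag a).
have rD i : root D (q i).
  rewrite /root !hornerE horner_sum (bigD1 i) //= big1 ?addr0.
    by rewrite hornerE lag_node eqxx mulr1 subrr.
  by move=> j ji; rewrite hornerE lag_node (negbTE ji) mulr0.
have [S hS sS] := nodal_dvd rD.
suff S0 : S = 0 by rewrite hS S0 mul0r.
by apply/eqP; rewrite -size_poly_eq0 -leqn0; apply: leq_trans sS _; rewrite leqn0 subn_eq0.
Qed.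

Lemma mono_err_lt i : (i < r)%N -> mono_err i = 0.
Proof.
move=> ir; rewrite /mono_err [X in X - _]lag_exact ?size_polyXn //.
by rewrite -sumrB big1 // => a _; rewrite hornerXn subrr.
Qed.

Lemma mono_errE i x : (mono_err i).[x] = x ^+ i - \sum_a (lag a).[x] * q a ^+ i.
Proof.
rewrite !hornerE horner_sum; congr (_ - _); apply: eq_bigr => a _.
by rewrite hornerE mulrC.
Qed.

Lemma mono_err_dvd i : (r <= i)%N ->
  exists2 S, mono_err i = S * nodal & (size S <= i.+1 - r)%N.
Proof.
move=> ri; have [|S hS sS] := @nodal_dvd (mono_err i).
  move=> j; rewrite /root mono_errE (bigD1 j) //= big1 ?addr0.
    by rewrite lag_node eqxx mul1r subrr.
  by move=> k kj; rewrite lag_node (negbTE kj) mul0r.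
exists S => //; apply: leq_trans sS _; apply: leq_sub2r.
apply: leq_trans (size_polyD _ _) _; rewrite geq_max size_polyXn leqnn size_polyN /=.
apply: (big_ind (fun p : {poly R} => (size p <= i.+1)%N)).
- by rewrite size_poly0.
- by move=> x y hx hy; apply: leq_trans (size_polyD _ _) _; rewrite geq_max hx.
- move=> a _; apply: leq_trans (size_scale_leq _ _) (leq_trans (size_lag a) _).
  exact: leqW.
Qed.

End Lagrange.

(** * Orthogonality of the nodal polynomial, exactness of the composite rule *)

Section Orthogonality.
Context {R : realType}.

(** Each differentiation costs at most one factor [A]. Hence the derivatives of [(X^2 - 1)^r] of
    order below [r] vanish at both ends of [[-1, 1]]. *)
Lemma derivn_exp_dvd (A : {poly R}) (n i : nat) : (i <= n)%N ->
  exists B, (A ^+ n)^`(i) = A ^+ (n - i) * B.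
Proof.
elim: i => [|i IH] hi; first by exists 1; rewrite subn0 mulr1.
have [B hB] := IH (ltnW hi).
have e : (n - i = (n - i.+1).+1)%N by lia.
exists ((A^`() * B) *+ (n - i) + A * B^`()).
rewrite derivnS hB derivM deriv_exp e /=.
rewrite exprS; ring.
Qed.

(* Repeated integration by parts: a primitive of [U^(j) S] vanishes at both ends. *)
Lemma primitive_by_parts (x y : R) (U : {poly R}) (j : nat) :
  (forall i, (i < j)%N -> (U^`(i)).[x] = 0 /\ (U^`(i)).[y] = 0) ->
  forall S : {poly R}, (size S <= j)%N ->
  exists T : {poly R}, [/\ T^`() = U^`(j) * S, T.[x] = 0 & T.[y] = 0].
Proof.
elim: j => [|j IH] hU S sS.
  exists 0; move: sS; rewrite leqn0 size_poly_eq0 => /eqP ->.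
  by rewrite deriv0 mulr0 !horner0.
have [||T [hT Tx Ty]] := IH _ S^`().
- by move=> i ij; apply: hU; apply: ltnW.
- have [->|S0] := eqVneq S 0; first by rewrite deriv0 size_poly0.
  have := lt_size_deriv S0; move: sS; lia.
have [Ux Uy] := hU j (ltnSn j).
exists (U^`(j) * S - T); rewrite !hornerE Ux Uy Tx Ty; split; [|by ring..].
rewrite derivB derivM hT derivnS; ring.
Qed.

(** Rodrigues' formula is integrated by parts on [[-1, 1]] and transported by [L], whose inverse is
    [M]. Orthogonality takes the form of a primitive with zero end values rather than of a zero
    integral, so that a composite rule can evaluate it by telescoping. *)
Lemma shifted_legendre_primitive (r : nat) (S : {poly R}) : (size S <= r)%N ->
  exists T : {poly R}, [/\ T^`() = shifted_legendre r * S, T.[0] = 0 & T.[1] = 0].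
Proof.
move=> sS; pose L := 2 *: 'X - 1 : {poly R}.
pose M := 2^-1 *: ('X + 1) : {poly R}.
have ML : M \Po L = 'X.
  rewrite /M comp_polyZ comp_polyD comp_polyX comp_polyC /L.
  by rewrite subrK scalerA mulVf ?scale1r.
pose U := ('X^2 - 1) ^+ r : {poly R}.
have hU i : (i < r)%N -> (U^`(i)).[-1] = 0 /\ (U^`(i)).[1] = 0.
  move=> ir; have [B ->] := derivn_exp_dvd ('X^2 - 1) (ltnW ir).
  rewrite !hornerE.
  have -> : (-1) ^+ 2 - 1 = 0 :> R by ring.
  have -> : 1 ^+ 2 - 1 = 0 :> R by ring.
  by rewrite expr0n subn_eq0 leqNgt ir /= !mul0r.
have sSM : (size (S \Po M) <= r)%N.
  rewrite size_comp_poly2 // /M size_scale ?invr_eq0 //.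
  by rewrite size_addl ?size_polyX ?size_poly1.
have [T [hT T1 T2]] := primitive_by_parts hU sSM.
(* The factor [2^-1] compensates the derivative 2 of [L] in the chain rule. *)
exists ((2^-1 * (2 ^+ r * r`!%:R)^-1) *: (T \Po L)); split.
- rewrite derivZ deriv_comp hT comp_polyM -comp_polyA ML comp_polyXr.
  have -> : L^`() = 2%:P :> {poly R}.
    by rewrite /L derivB derivZ derivX derivC subr0 alg_polyC.
  rewrite /shifted_legendre /legendre -/L -/U comp_polyZ -!scalerAl.
  rewrite [_ * 2%:P]mulrC mul_polyC scalerA; congr (_ *: _).
  by rewrite mulrAC mulVf ?mul1r.
- by rewrite hornerE horner_comp !hornerE ?sub0r T1 mulr0.
- rewrite hornerE horner_comp !hornerE.
  have -> : 2 - 1 = 1 :> R by ring.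
  by rewrite T2 mulr0.
Qed.

(** The leading coefficient of the monic [(X^2 - 1)^r] survives [r] derivatives, being multiplied by
    a nonzero falling factorial. *)
Lemma size_shifted_legendre (r : nat) : size (shifted_legendre r : {poly R}) = r.+1.
Proof.
rewrite /shifted_legendre size_comp_poly2; last first.
  rewrite size_addl ?size_scale ?size_polyX ?size_polyN ?size_poly1 //.
rewrite /legendre size_scale; last first.
  by rewrite invr_eq0 mulf_neq0 ?expf_neq0 // pnatr_eq0 -lt0n fact_gt0.
have s2 : size ('X^2 - 1 : {poly R}) = 3%N by rewrite size_XnsubC.
have m2 : ('X^2 - 1 : {poly R}) \is monic by rewrite monicXnsubC.
have sU : size (('X^2 - 1) ^+ r : {poly R}) = (r + r).+1.
  have U0 : (0 < size (('X^2 - 1) ^+ r : {poly R}))%N.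
    by rewrite size_poly_gt0 monic_neq0 ?monic_exp.
  by rewrite -(prednK U0) size_exp s2 mul2n addnn.
apply/eqP; rewrite eqn_leq; apply/andP; split.
  apply/leq_sizeP => j hj; rewrite coef_derivn nth_default ?mul0rn //.
  by rewrite sU; lia.
rewrite ltnNge; apply/negP => /leq_sizeP /(_ r (leqnn _)) /eqP.
rewrite coef_derivn mulrn_eq0.
have -> : (r + r = (size (('X^2 - 1) ^+ r : {poly R})).-1)%N by rewrite sU.
rewrite -lead_coefE (monicP (monic_exp _ m2)) oner_eq0 orbF sU /=.
by rewrite -leqn0 leqNgt ffact_gt0 leq_addr.
Qed.

(** A polynomial of degree [r] with [r] distinct roots is a nonzero constant times [nodal], so the
    primitive for the Legendre polynomial only has to be rescaled. *)
Lemma nodal_primitive (r : nat) (q : 'I_r -> R) (S : {poly R}) :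
  legendre_zeros q -> injective q -> (size S <= r)%N ->
  exists T : {poly R}, [/\ T^`() = nodal q * S, T.[0] = 0 & T.[1] = 0].
Proof.
move=> [_ _ qroot] q_inj sS.
have [c hc sc] := nodal_dvd q_inj qroot.
rewrite size_shifted_legendre subSnn in sc.
move: (c`_0) (size1_polyC sc) => {sc} k ck.
have k0 : k != 0.
  apply/eqP => k0; have := size_shifted_legendre r.
  by rewrite hc ck k0 mul0r size_poly0.
have [T [hT T0 T1]] := shifted_legendre_primitive sS.
exists (k^-1 *: T); rewrite !hornerE T0 T1 !mulr0; split=> //.
rewrite derivZ hT hc ck mul_polyC -!scalerAl scalerA.
by rewrite mulVf // scale1r.
Qed.

Lemma quad_exact_primitive (rho : nat) (w mu : 'I_rho -> R) (deg : nat)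
    (T : {poly R}) : quad_exact w mu deg -> (size T^`() <= deg.+1)%N ->
  \sum_(i < rho) w i * (T^`()).[mu i] = T.[1] - T.[0].
Proof.
move=> hex sT; rewrite -hex //.
rewrite /Rintegral (@continuous_FTC2 _ (fun t => (T^`()).[t]) (fun t => T.[t])) //=.
- exact: continuous_subspaceT (@continuous_horner _ _).
- split.
  + by move=> x _; apply: derivable_horner.
  + by apply: cvg_at_right_filter; apply: continuous_horner.
  + by apply: cvg_at_left_filter; apply: continuous_horner.
- by move=> x _; rewrite derivE.
Qed.

(** On the [l]-th of [p] cells, the basic rule applied to the derivative of [p * T((x + l) / p)]
    returns [p] times the increment of [T] over that cell; the increments telescope. *)
Lemma composite_exact (rho : nat) (w mu : 'I_rho -> R) (deg p : nat)
    (T : {poly R}) : quad_exact w mu deg -> (size T^`() <= deg.+1)%N -> (0 < p)%N ->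
  \sum_(l < p) \sum_(i < rho) w i * (T^`()).[(l%:R + mu i) / p%:R]
    = p%:R * (T.[1] - T.[0]).
Proof.
move=> hex sT p0; have p0R : p%:R != 0 :> R by rewrite pnatr_eq0 -lt0n.
pose F (l : nat) := p%:R * T.[l%:R / p%:R].
transitivity (\sum_(0 <= l < p) (F l.+1 - F l)); last first.
  by rewrite telescope_sumr // /F mul0r divff // mulrBr.
rewrite big_mkord; apply: eq_bigr => l _.
pose L : {poly R} := p%:R^-1 *: ('X + l%:R%:P).
have L' : L^`() = (p%:R^-1)%:P.
  by rewrite /L derivZ derivD derivX derivC addr0 alg_polyC.
have sL : size L = 2%N.
  by rewrite size_scale ?invr_eq0 // size_XaddC.
have e : (p%:R *: (T \Po L))^`() = T^`() \Po L.
  by rewrite derivZ deriv_comp L' mulrC mul_polyC scalerA divff // scale1r.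
have := @quad_exact_primitive _ w mu deg (p%:R *: (T \Po L)) hex.
rewrite e size_comp_poly2 // => /(_ sT).
rewrite !hornerE !horner_comp /L !hornerE /F => H.
rewrite -natr1 ![_ / p%:R]mulrC [l%:R + 1]addrC -H.
by apply: eq_bigr => i _; rewrite horner_comp !hornerE addrC [_ / _]mulrC.
Qed.

(** For [i < r] the error is zero. Otherwise it is [S * nodal] with [S] of degree at most [i - r],
    so [S * 'X^j] has degree below [r] and is orthogonal to [nodal]; the full product has degree at
    most [2 r - 1], within the exactness of the rule. *)
Lemma mono_err_orthogonal (r rho : nat) (q : 'I_r -> R) (w mu : 'I_rho -> R)
    (p i j : nat) : quad_exact w mu (2 * r - 1) -> legendre_zeros q ->
  injective q -> (0 < p)%N -> (j < r)%N -> (i + j < 2 * r)%N ->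
  \sum_(l < p) \sum_(c < rho) w c *
     (((l%:R + mu c) / p%:R) ^+ j * (mono_err q i).[(l%:R + mu c) / p%:R]) = 0.
Proof.
move=> hex hq q_inj p0 jr ij.
have [ir|ri] := ltnP i r.
  rewrite big1 // => l _; rewrite big1 // => c _.
  by rewrite mono_err_lt // horner0 !mulr0.
have [S hS sS] := mono_err_dvd q_inj ri.
have sSj : (size (S * 'X^j)%R <= r)%N.
  have [->|S0] := eqVneq S 0; first by rewrite mul0r size_poly0.
  by rewrite size_mulXn //; lia.
have [T [hT T0 T1]] := nodal_primitive hq q_inj sSj.
have sT : (size T^`() <= (2 * r - 1).+1)%N.
  rewrite hT; apply: leq_trans (size_polyMleq _ _) _.
  rewrite size_nodal; lia.
have := composite_exact hex sT p0; rewrite T0 T1 subrr mulr0 => E; rewrite -[RHS]E.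
apply: eq_bigr => l _; apply: eq_bigr => c _.
rewrite hT hS !hornerM hornerXn; congr (w c * _).
by rewrite mulrC -mulrA mulrCA.
Qed.

End Orthogonality.

(** * Continuity on the domain of the kernel *)

Section Ultralimits.
Context {R : realType}.

(** Along one such ultrafilter all bounded real sequences converge simultaneously, which replaces
    nested and diagonal extractions. *)
Lemma exists_ultra_late : exists2 U : set_system nat, UltraFilter U &
  forall N, U [set n | (N <= n)%N].
Proof.
have [U [UU oU]] := @ultraFilterLemma nat eventually _.
by exists U => // N; apply: oU; exists N.
Qed.

Lemma ultra_fmap (S T : Type) (f : S -> T) (U : set_system S) :
  UltraFilter U -> UltraFilter (fmap f U).
Proof.
move=> UU; split; first exact: fmap_proper_filter.
move=> G GG UG; rewrite eqEsubset; split => // A GA.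
have [//|UA] := in_ultra_setVsetC (f @^-1` A) UU.
have GnA : G (~` A) by apply: UG.
by have [z []] := filter_ex (filterI GA GnA).
Qed.

Lemma ultra_lim (U : set_system nat) (x : nat -> R) (lo hi : R) :
  UltraFilter U -> U [set n | lo <= x n <= hi] ->
  exists2 l, lo <= l <= hi & forall e : R, 0 < e -> U [set n | `|l - x n| < e].
Proof.
move=> UU Ux.
have cpt := @segment_compact R lo hi.
rewrite compact_ultra in cpt.
have FU : UltraFilter (x @ U) by exact: ultra_fmap.
have [|l [lI hl]] := cpt _ FU.
  change (U (x @^-1` [set` `[lo, hi]])).
  by apply: filterS Ux => n hn; rewrite /= in_itv.
exists l; first by move: lI; rewrite /= in_itv.
by move=> e e0; have /cvgrPdist_lt := hl; apply.
Qed.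

End Ultralimits.

(** * Boundedness and uniform continuity on compact parts of the domain *)

Section Continuity.
Context {R : realType} (a b : R).
Local Notation I := `[a, b].

Lemma within_continuousP (g : R -> R) : {within [set` I], continuous g} <->
  (forall x, x \in I -> forall e : R, 0 < e -> exists2 d : R, 0 < d &
   forall y, y \in I -> `|y - x| < d -> `|g x - g y| < e).
Proof.
rewrite subspace_continuousP; split.
- move=> h x xI e e0; have /cvgrPdist_lt /(_ e e0) := h x xI.
  rewrite near_withinE => /nbhs_ballP[d /= d0 hd]; exists d => // y yI yx.
  by apply: hd => //; rewrite /ball /= distrC.
- move=> h x xI; apply/cvgrPdist_lt => e e0; have [d d0 hd] := h x xI e e0.
  rewrite near_withinE; apply/nbhs_ballP; exists d => //= y yx yI.
  by apply: hd => //; move: yx; rewrite /ball /= distrC.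
Qed.

Lemma continuous_OmegaE (F : R -> R -> R -> R) : continuous_Omega a b F <->
  (forall s t u, s \in I -> t \in I -> forall e : R, 0 < e -> exists2 d : R, 0 < d &
   forall s' t' u', s' \in I -> t' \in I ->
     `|s' - s| < d -> `|t' - t| < d -> `|u' - u| < d -> `|F s t u - F s' t' u'| < e).
Proof.
rewrite /continuous_Omega subspace_continuousP; split=> h.
- move=> s t u sI tI e e0; have /cvgrPdist_lt /(_ e e0) := h (s, t, u) (conj sI tI).
  rewrite near_withinE => /nbhs_ballP[d /= d0 hd]; exists d => //.
  move=> s' t' u' s'I t'I ss' tt' uu'.
  apply: (hd (s', t', u')); last by split.
  by split => /=; [split|]; rewrite /ball /= distrC.
- move=> [[s t] u] [/= sI tI]; apply/cvgrPdist_lt => e e0.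
  have [d d0 hd] := h s t u sI tI e e0.
  rewrite near_withinE; apply/nbhs_ballP; exists d => //= -[[s' t'] u'].
  move=> [[/= ss' tt'] uu'] [/= s'I t'I]; move: ss' tt' uu'; rewrite /ball /= => *.
  by apply: hd; rewrite // distrC.
Qed.

Lemma continuous_OmegaP (F : R -> R -> R -> R) : continuous_Omega a b F ->
  forall s t u, s \in I -> t \in I -> forall e : R, 0 < e -> exists2 d : R, 0 < d &
   forall s' t' u', s' \in I -> t' \in I ->
     `|s' - s| < d -> `|t' - t| < d -> `|u' - u| < d -> `|F s t u - F s' t' u'| < e.
Proof. by move=> /continuous_OmegaE. Qed.

(** Points where [|F|] exceeds [n] would have a limit along the ultrafilter, near which continuity
    bounds [F]. The restriction on [u] supplies the compactness that the domain itself does not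
    have. *)
Lemma Omega_bounded (F : R -> R -> R -> R) : continuous_Omega a b F ->
  forall M, exists B, forall s t u, s \in I -> t \in I -> `|u| <= M ->
    `|F s t u| <= B.
Proof.
move=> cF M; apply: contrapT => /forallNP H.
have {}H (n : nat) : exists z : R * R * R, [/\ z.1.1 \in I, z.1.2 \in I,
    `|z.2| <= M & n%:R < `|F z.1.1 z.1.2 z.2|].
  apply: contrapT => Hn; apply: (H n%:R) => s t u sI tI uM.
  by rewrite leNgt; apply/negP => c; apply: Hn; exists (s, t, u).
have [z hz] := choice H.
have [U UU lateU] := exists_ultra_late.
have inI (y : nat -> R) : (forall n, y n \in I) -> U [set n | a <= y n <= b].
  by move=> hy; apply: filterS filterT => n _; have := hy n; rewrite in_itv.
have [|s sI hs] := @ultra_lim R U (fun n => (z n).1.1) a b UU.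
  by apply: inI => n; have [] := hz n.
have [|t tI ht] := @ultra_lim R U (fun n => (z n).1.2) a b UU.
  by apply: inI => n; have [] := hz n.
have [|u uI hu] := @ultra_lim R U (fun n => (z n).2) (- M) M UU.
  by apply: filterS filterT => n _; have [_ _] := hz n; rewrite ler_norml.
have [d d0 hd] := @continuous_OmegaP F cF s t u sI tI 1 ltr01.
have [N hN] : exists N : nat, `|F s t u| + 1 < N%:R.
  by exists (Num.bound (`|F s t u| + 1)); apply: archi_boundP; rewrite addr_ge0.
have [n [[[/= c1 c2] c3] c4]] :=
  filter_ex (filterI (filterI (filterI (hs d d0) (ht d d0)) (hu d d0)) (lateU N)).
have [h1 h2 h3 h4] := hz n.
rewrite distrC in c1; rewrite distrC in c2; rewrite distrC in c3.
have := hd _ _ (z n).2 h1 h2 c1 c2 c3.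
have : N%:R <= n%:R :> R by rewrite ler_nat.
move: (F _ _ _) (F s t u) hN h4 => y y' hN h4 h5.
rewrite ltNge => /negP; apply.
by have := lerB_dist y y'; rewrite distrC; lra.
Qed.

(** Same scheme: the two points of the [n]-th bad pair are closer than [1 / (n + 1)] in each
    coordinate, hence both approach one limit, at which continuity is contradicted. *)
Lemma Omega_unif (F : R -> R -> R -> R) : continuous_Omega a b F ->
  forall M e : R, 0 < e -> exists2 d : R, 0 < d & forall s s' t t' u u',
    s \in I -> s' \in I -> t \in I -> t' \in I -> `|u| <= M -> `|u'| <= M ->
    `|s' - s| < d -> `|t' - t| < d -> `|u' - u| < d ->
    `|F s t u - F s' t' u'| < e.
Proof.
move=> cF M e e0; apply: contrapT => H.
have {}H (n : nat) : exists z : (R * R * R) * (R * R * R),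
   [/\ [/\ z.1.1.1 \in I, z.1.1.2 \in I & `|z.1.2| <= M],
    [/\ z.2.1.1 \in I, z.2.1.2 \in I & `|z.2.2| <= M],
    [/\ `|z.2.1.1 - z.1.1.1| < n.+1%:R^-1, `|z.2.1.2 - z.1.1.2| < n.+1%:R^-1
     & `|z.2.2 - z.1.2| < n.+1%:R^-1] &
   e <= `|F z.1.1.1 z.1.1.2 z.1.2 - F z.2.1.1 z.2.1.2 z.2.2|].
  apply: contrapT => Hn; apply: H; exists n.+1%:R^-1; first by rewrite invr_gt0 ltr0n.
  move=> s s' t t' u u' hs hs' ht ht' hu hu' h1 h2 h3.
  by rewrite ltNge; apply/negP => c; apply: Hn; exists (s, t, u, (s', t', u')).
have [z hz] := choice H.
have [U UU lateU] := exists_ultra_late.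
have inI (y : nat -> R) : (forall n, y n \in I) -> U [set n | a <= y n <= b].
  by move=> hy; apply: filterS filterT => n _; have := hy n; rewrite in_itv.
have [|s sI hs] := @ultra_lim R U (fun n => (z n).1.1.1) a b UU.
  by apply: inI => n; have [[]] := hz n.
have [|t tI ht] := @ultra_lim R U (fun n => (z n).1.1.2) a b UU.
  by apply: inI => n; have [[]] := hz n.
have [|u uI hu] := @ultra_lim R U (fun n => (z n).1.2) (- M) M UU.
  by apply: filterS filterT => n _; have [[_ _ +] _ _ _] := hz n; rewrite ler_norml.
have e20 : 0 < e / 2 by rewrite divr_gt0.
have [d d0 hd] := @continuous_OmegaP F cF s t u sI tI _ e20.
have d20 : 0 < d / 2 by rewrite divr_gt0.
have [N hN] : exists N : nat, (d / 2)^-1 < N%:R.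
  by exists (Num.bound (d / 2)^-1); apply: archi_boundP; rewrite invr_ge0 ltW.
have [n [[[/= c1 c2] c3] c4]] :=
  filter_ex (filterI (filterI (filterI (hs _ d20) (ht _ d20)) (hu _ d20)) (lateU N)).
have [[h1 h2 _] [h3 h4 _] [h5 h6 h7] h8] := hz n.
have nd : n.+1%:R^-1 < d / 2.
  rewrite invf_plt ?posrE ?ltr0n //; apply: lt_trans hN _.
  by rewrite ltr_nat ltnS.
have E1 := hd _ _ (z n).1.2 h1 h2.
have E2 := hd _ _ (z n).2.2 h3 h4.
move: (_^-1) nd h5 h6 h7 => dn nd h5 h6 h7.
rewrite !ltr_norml in c1 c2 c3 h5 h6 h7 E1 E2.
have {}E1 : - (e / 2) < F s t u - F (z n).1.1.1 (z n).1.1.2 (z n).1.2 < e / 2.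
  by apply: E1; lra.
have {}E2 : - (e / 2) < F s t u - F (z n).2.1.1 (z n).2.1.2 (z n).2.2 < e / 2.
  by apply: E2; lra.
move: h8; rewrite leNgt => /negP; apply; rewrite ltr_norml; lra.
Qed.

Lemma continuous_Omega_sub (F : R -> R -> R -> R) (x : R -> R) :
  continuous_Omega a b F -> {within [set` I], continuous x} ->
  forall s, s \in I -> {within [set` I], continuous (fun t => F s t (x t))}.
Proof.
move=> cF /within_continuousP cx s sI; apply/within_continuousP => t tI e e0.
have [d d0 hd] := @continuous_OmegaP F cF s t (x t) sI tI e e0.
have [d' d'0 hd'] := cx t tI d d0.
exists (Num.min d d'); first by rewrite lt_min d0.
move=> t' t'I; rewrite lt_min => /andP[h1 h2]; apply: hd => //.
  by rewrite subrr normr0.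
by rewrite distrC; apply: hd'.
Qed.

(** A function of [t] alone is viewed as a kernel, so that boundedness and uniform continuity in one
    variable become instances of the kernel statements. *)
Lemma continuous_Omega_t (x : R -> R) : {within [set` I], continuous x} ->
  continuous_Omega a b (fun _ t _ => x t).
Proof.
move=> /within_continuousP cx; apply/continuous_OmegaE => s t u sI tI e e0.
by have [d d0 hd] := cx t tI e e0; exists d => // s' t' u' _ t'I _ tt' _; apply: hd.
Qed.

Lemma within_bounded (x : R -> R) : {within [set` I], continuous x} ->
  exists B, forall t, t \in I -> `|x t| <= B.
Proof.
move=> /continuous_Omega_t cF; have [B hB] := Omega_bounded cF 0.
by exists B => t tI; apply: (hB t t 0) => //; rewrite normr0.
Qed.

Lemma within_unif (x : R -> R) : {within [set` I], continuous x} ->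
  forall e : R, 0 < e -> exists2 d : R, 0 < d & forall t t', t \in I -> t' \in I ->
    `|t' - t| < d -> `|x t - x t'| < e.
Proof.
move=> /continuous_Omega_t cF e e0; have [d d0 hd] := Omega_unif cF 0 e0.
exists d => // t t' tI t'I tt'.
by apply: (hd t t t t' 0 0) => //; rewrite ?subrr ?normr0.
Qed.

End Continuity.

(** * Calculus on a closed interval *)

Section RelativeDerivative.
Context {R : realType} (a b : R).
Local Notation I := `[a, b].

(** A relation rather than the function [derive_on], so that a derivative may be given by any
    formula valid on the interval; [derivable_on_deriv] and [deriv_itvE] pass from one to the
    other. *)
Definition deriv_itv (g g' : R -> R) : Prop :=
  forall x, x \in I -> quot g x y @[y --> within [set` I] x^'] --> g' x.

Lemma deriv_itvP (g g' : R -> R) : deriv_itv g g' <->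
  forall x, x \in I -> forall e : R, 0 < e -> exists2 d : R, 0 < d &
   forall y, y \in I -> y != x -> `|y - x| < d -> `|g' x - quot g x y| < e.
Proof.
split=> h x xI.
- move=> e e0; have /cvgrPdist_lt /(_ e e0) := h x xI.
  rewrite near_withinE => /nbhs_ballP[d /= d0 hd]; exists d => // y yI yx xy.
  by apply: hd => //; rewrite /ball /= distrC.
- apply/cvgrPdist_lt => e e0; have [d d0 hd] := h x xI e e0.
  rewrite near_withinE; apply/nbhs_ballP; exists d => //= y yx xy yI.
  by apply: hd => //; move: yx; rewrite /ball /= distrC.
Qed.

Lemma deriv_itv_ext (g1 g2 g' : R -> R) : {in I, g1 =1 g2} ->
  deriv_itv g1 g' -> deriv_itv g2 g'.
Proof.
move=> e12 /deriv_itvP h; apply/deriv_itvP => x xI e e0.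
have [d d0 hd] := h x xI e e0; exists d => // y yI yx xy.
by rewrite /quot -!e12 //; apply: hd.
Qed.

Lemma deriv_itv_continuous (g g' : R -> R) :
  deriv_itv g g' -> {within [set` I], continuous g}.
Proof.
move=> /deriv_itvP h; apply/within_continuousP => x xI e e0.
have [d d0 hd] := h x xI 1 ltr01.
pose K := `|g' x| + 1; have K0 : 0 < K by rewrite ltr_wpDl.
exists (Num.min d (e / K)); first by rewrite lt_min d0 divr_gt0.
move=> y yI; rewrite lt_min => /andP[yd ye].
have [->|yx] := eqVneq y x; first by rewrite subrr normr0.
have yx0 : y - x != 0 by rewrite subr_eq0.
have -> : g x - g y = - (quot g x y * (y - x)) by rewrite /quot mulfVK // opprB.
rewrite normrN normrM; apply: le_lt_trans (_ : K * `|y - x| < e).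
  apply: ler_wpM2r => //; have := hd y yI yx yd.
  by have := lerB_dist (quot g x y) (g' x); rewrite /K distrC; lra.
by rewrite mulrC -ltr_pdivlMr.
Qed.

Lemma deriv_itvD (g1 g1' g2 g2' : R -> R) : deriv_itv g1 g1' -> deriv_itv g2 g2' ->
  deriv_itv (fun x => g1 x + g2 x) (fun x => g1' x + g2' x).
Proof.
move=> h1 h2 x xI.
suff -> : quot (fun x => g1 x + g2 x) x = fun y => quot g1 x y + quot g2 x y.
  by apply: cvgD; [exact: h1|exact: h2].
by apply/funext => y; rewrite /quot; ring.
Qed.

Lemma deriv_itvZ (c : R) (g g' : R -> R) : deriv_itv g g' ->
  deriv_itv (fun x => c * g x) (fun x => c * g' x).
Proof.
move=> h x xI.
suff -> : quot (fun x => c * g x) x = fun y => c * quot g x y.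
  by apply: cvgM; [exact: cvg_cst|exact: h].
by apply/funext => y; rewrite /quot; ring.
Qed.

Lemma deriv_itvM (g1 g1' g2 g2' : R -> R) : deriv_itv g1 g1' -> deriv_itv g2 g2' ->
  deriv_itv (fun x => g1 x * g2 x) (fun x => g1' x * g2 x + g1 x * g2' x).
Proof.
move=> h1 h2 x xI.
have c2 : g2 y @[y --> within [set` I] x^'] --> g2 x.
  have /deriv_itv_continuous /within_continuousP c := h2.
  apply/cvgrPdist_lt => e e0; have [d d0 hd] := c x xI e e0.
  rewrite near_withinE; apply/nbhs_ballP; exists d => //= y yx xy yI.
  by apply: hd => //; move: yx; rewrite /ball /= distrC.
suff -> : quot (fun x => g1 x * g2 x) x =
    fun y => quot g1 x y * g2 y + g1 x * quot g2 x y.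
  apply: cvgD; apply: cvgM; [exact: h1|exact: c2|exact: cvg_cst|exact: h2].
by apply/funext => y; rewrite /quot; ring.
Qed.

Hypothesis ab : a < b.

(** Since [a < b], each punctured neighbourhood meets the interval, to the right of [x] or, at [b],
    to the left. This makes the limit defining [derive_on] unique. *)
Lemma within_dnbhs_proper (x : R) : x \in I -> ProperFilter (within [set` I] x^').
Proof.
move=> xI; apply: Build_ProperFilter => P.
have /nbhs_ballP[d /= d0 hd] : nbhs x [set y | y != x -> y \in I -> False] := P.
move: xI; rewrite in_itv /= => /andP[ax xb].
have [xb'|bx] := ltP x b.
  pose y := x + Num.min (d / 2) (b - x).
  have m0 : 0 < Num.min (d / 2) (b - x) by rewrite lt_min divr_gt0 // subr_gt0.
  have m1 : Num.min (d / 2) (b - x) <= d / 2 by rewrite ge_min lexx.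
  have m2 : Num.min (d / 2) (b - x) <= b - x by rewrite ge_min lexx orbT.
  apply: (hd y).
  - by rewrite /ball /= /y opprD addrA subrr sub0r normrN gtr0_norm //; lra.
  - by apply/eqP; rewrite /y; lra.
  - by rewrite /= in_itv /= /y; lra.
pose y := x - Num.min (d / 2) (b - a).
have m0 : 0 < Num.min (d / 2) (b - a) by rewrite lt_min divr_gt0 // subr_gt0.
have m1 : Num.min (d / 2) (b - a) <= d / 2 by rewrite ge_min lexx.
have m2 : Num.min (d / 2) (b - a) <= b - a by rewrite ge_min lexx orbT.
apply: (hd y).
- by rewrite /ball /= /y opprB addrCA subrr addr0 gtr0_norm //; lra.
- by apply/eqP; rewrite /y; lra.
- by rewrite /= in_itv /= /y; lra.
Qed.

Lemma deriv_itv_derivable (g g' : R -> R) : deriv_itv g g' ->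
  {in I, forall x, derivable_on [set` I] g x}.
Proof. by move=> h x xI; apply/cvg_ex; exists (g' x); apply: h. Qed.

Lemma deriv_itvE (g g' : R -> R) : deriv_itv g g' ->
  {in I, derive_on [set` I] g =1 g'}.
Proof.
move=> h x xI; have ? := within_dnbhs_proper xI.
by apply: cvg_lim => //; apply: h.
Qed.

Lemma derivable_on_deriv (g : R -> R) : {in I, forall x, derivable_on [set` I] g x} ->
  deriv_itv g (derive_on [set` I] g).
Proof. by move=> h x xI; apply: h. Qed.

Lemma deriv_itv_is_derive (g g' : R -> R) : deriv_itv g g' ->
  {in `]a, b[, forall x : R, is_derive x 1 g (g' x)}.
Proof.
move=> /deriv_itvP h x; rewrite in_itv /= => /andP[ax xb].
have xI : x \in I by rewrite in_itv /= !ltW.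
have H : h^-1 *: (g (h *: 1 + x) - g x) @[h --> 0^'] --> g' x.
  apply/cvgrPdist_lt => e e0; have [d d0 hd] := h x xI e e0.
  have m0 : 0 < Num.min d (Num.min (x - a) (b - x)).
    by rewrite !lt_min d0 !subr_gt0 ax.
  rewrite near_withinE; apply/nbhs_ballP; exists (Num.min d (Num.min (x - a) (b - x))) => //= k.
  rewrite /ball /= sub0r normrN !lt_min => /and3P[kd ka kb] k0.
  rewrite [k *: 1]mulr1; have := hd (k + x); rewrite /quot addrK.
  rewrite [k^-1 *: _]mulrC; apply => //.
  - by move: ka kb; rewrite !ltr_norml in_itv /=; lra.
  - by apply: contra_neq k0 => /eqP; rewrite -subr_eq0 addrK => /eqP.
apply: DeriveDef; last exact: cvg_lim H.
by apply/cvg_ex; exists (g' x).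
Qed.

Lemma deriv_itv_MVT (g g' : R -> R) : deriv_itv g g' -> forall x y,
  x \in I -> y \in I -> exists c, [/\ c \in I, `|c - x| <= `|y - x|
    & g y - g x = g' c * (y - x)].
Proof.
move=> h.
have key x y : x \in I -> y \in I -> x <= y ->
    exists2 c, x <= c <= y & g y - g x = g' c * (y - x).
  rewrite !in_itv /= => /andP[ax xb] /andP[ay yb] xy.
  have [|| c cI hc] := @MVT_segment R g g' x y xy.
  - move=> z; rewrite in_itv /= => /andP[xz zy].
    by apply: deriv_itv_is_derive => //; rewrite in_itv /=; lra.
  - apply: (@continuous_subspaceW _ _ _ [set` I]); last exact: deriv_itv_continuous h.
    by move=> z; rewrite /= !in_itv /=; lra.
  - by exists c => //; move: cI; rewrite in_itv.
move=> x y xI yI; have [xy|yx] := leP x y.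
  have [c cxy hc] := key x y xI yI xy; exists c; split => //.
    by move: xI yI cxy; rewrite !in_itv /=; lra.
  by rewrite !ger0_norm ?subr_ge0 //; lra.
have [c cxy hc] := key y x yI xI (ltW yx); exists c; split.
- by move: xI yI cxy; rewrite !in_itv /=; lra.
- by rewrite !ler0_norm ?subr_le0 //; lra.
- by rewrite -opprB hc; ring.
Qed.

End RelativeDerivative.

(** * Functions with one bound for all derivatives, and Taylor expansion *)

Section BoundedDerivatives.
Context {R : realType} (a b : R).
Local Notation I := `[a, b].

(** Quantitative form of [C_itv]: the single constant [B] bounds the function and its derivatives up
    to order [k], which allows statements uniform over a family of functions. *)
Fixpoint Cb (k : nat) (B : R) (g : R -> R) : Prop :=
  [/\ {within [set` I], continuous g}, forall x, x \in I -> `|g x| <= B &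
   if k is k'.+1 then exists2 g', deriv_itv a b g g' & Cb k' B g' else True].

Lemma Cb_ext k B g1 g2 : {in I, g1 =1 g2} -> Cb k B g1 -> Cb k B g2.
Proof.
move=> e12; have c12 : {within [set` I], continuous g1} ->
    {within [set` I], continuous g2}.
  move=> /within_continuousP c; apply/within_continuousP => x xI e e0.
  have [d d0 hd] := c x xI e e0; exists d => // y yI.
  by rewrite -!e12 //; apply: hd.
case: k => [|k] [/c12 c h] => [_|[g' hg' Cg']]; split => //.
- by move=> x xI; rewrite -e12 //; apply: h.
- by move=> x xI; rewrite -e12 //; apply: h.
- by exists g' => //; apply: deriv_itv_ext hg'.
Qed.

Lemma Cb_continuous k B g : Cb k B g -> {within [set` I], continuous g}.
Proof. by case: k => [|k] []. Qed.

Lemma Cb_bound k B g : Cb k B g -> forall x, x \in I -> `|g x| <= B.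
Proof. by case: k => [|k] []. Qed.

Lemma Cb_le k k' B B' g : (k' <= k)%N -> B <= B' -> Cb k B g -> Cb k' B' g.
Proof.
move=> + BB; elim: k k' g => [|k IH] [|k'] g //= kk [c h].
- by move=> _; split => // x xI; apply: le_trans (h x xI) BB.
- by move=> _; split => // x xI; apply: le_trans (h x xI) BB.
- move=> [g' hg' Cg']; split => // [x xI|]; first exact: le_trans (h x xI) BB.
  by exists g' => //; apply: IH.
Qed.

Lemma CbD k B1 B2 g1 g2 : Cb k B1 g1 -> Cb k B2 g2 ->
  Cb k (B1 + B2) (fun x => g1 x + g2 x).
Proof.
elim: k g1 g2 => [|k IH] g1 g2 /= [c1 h1 d1] [c2 h2 d2]; split => //.
- exact: within_continuousD.
- by move=> x xI; apply: le_trans (ler_normD _ _) (lerD (h1 x xI) (h2 x xI)).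
- exact: within_continuousD.
- by move=> x xI; apply: le_trans (ler_normD _ _) (lerD (h1 x xI) (h2 x xI)).
- case: d1 d2 => [g1' hg1 C1] [g2' hg2 C2].
  exists (fun x => g1' x + g2' x); first exact: deriv_itvD.
  exact: IH.
Qed.

Lemma within_continuousM_itv (g1 g2 : R -> R) : {within [set` I], continuous g1} ->
  {within [set` I], continuous g2} ->
  {within [set` I], continuous (fun x => g1 x * g2 x)}.
Proof.
move=> c1 c2 x; apply: (@continuousM R (subspace [set` I])); [exact: c1|exact: c2].
Qed.

Lemma within_continuous_ext (g1 g2 : R -> R) : {in I, g1 =1 g2} ->
  {within [set` I], continuous g1} -> {within [set` I], continuous g2}.
Proof.
move=> e12 /within_continuousP c; apply/within_continuousP => x xI e e0.
have [d d0 hd] := c x xI e e0; exists d => // y yI.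
by rewrite -!e12 //; apply: hd.
Qed.

Hypothesis ab : a < b.

Lemma left_in_itv : a \in I. Proof. by rewrite in_itv /= lexx ltW. Qed.

Lemma Cb_ge0 k B g : Cb k B g -> 0 <= B.
Proof. by move=> /Cb_bound /(_ a left_in_itv); apply: le_trans. Qed.

(** The factor [2 ^+ k] counts the terms of Leibniz' rule, doubled by each derivative. *)
Lemma CbM k B1 B2 g1 g2 : Cb k B1 g1 -> Cb k B2 g2 ->
  Cb k (2 ^+ k * (B1 * B2)) (fun x => g1 x * g2 x).
Proof.
elim: k g1 g2 => [|k IH] g1 g2 C1 C2; have B10 := Cb_ge0 C1; have B20 := Cb_ge0 C2.
  have [c1 h1 _] := C1; have [c2 h2 _] := C2.
  split => //; first exact: within_continuousM_itv.
  by move=> x xI; rewrite expr0 mul1r normrM ler_pM ?h1 ?h2.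
have [c1 h1 [g1' hg1 C1']] := C1; have [c2 h2 [g2' hg2 C2']] := C2.
split; first exact: within_continuousM_itv.
  move=> x xI; rewrite normrM -[leLHS]mul1r ler_pM ?ler_pM ?h1 ?h2 ?mulr_ge0 //.
  by rewrite exprn_ege1 // ler1n.
exists (fun x => g1' x * g2 x + g1 x * g2' x); first exact: deriv_itvM.
have -> : 2 ^+ k.+1 * (B1 * B2) = 2 ^+ k * (B1 * B2) + 2 ^+ k * (B1 * B2).
  by rewrite exprS; ring.
have C1k := Cb_le (leqnSn k) (lexx B1) C1.
have C2k := Cb_le (leqnSn k) (lexx B2) C2.
by apply: CbD; apply: IH.
Qed.

Lemma C_itv_ext k g1 g2 : {in I, g1 =1 g2} -> C_itv a b k g1 -> C_itv a b k g2.
Proof.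
elim: k g1 g2 => [|k IH] g1 g2 e12 /= [c].
  by split => //; apply: within_continuous_ext c.
move=> [d C]; split; first exact: within_continuous_ext c.
have /(deriv_itv_ext e12) D := derivable_on_deriv d.
split; first exact: deriv_itv_derivable D.
by apply: IH C => x xI; rewrite (deriv_itvE ab D).
Qed.

Lemma C_itvS k g g' : deriv_itv a b g g' -> C_itv a b k g' -> C_itv a b k.+1 g.
Proof.
move=> D C; split; first exact: deriv_itv_continuous D.
split; first exact: deriv_itv_derivable D.
by apply: C_itv_ext C => x xI; rewrite (deriv_itvE ab D).
Qed.

Lemma Cb_C_itv k B g : Cb k B g -> C_itv a b k g.
Proof.
elim: k g => [|k IH] g; first by case.
by move=> [_ _ [g' hg' /IH Cg']]; apply: C_itvS Cg'.
Qed.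

Lemma C_itv_Cb k g : C_itv a b k g -> exists B, Cb k B g.
Proof.
elim: k g => [|k IH] g [c].
  by move=> _; have [B hB] := within_bounded c; exists B.
move=> [d /IH[B' C']]; have [B hB] := within_bounded c.
exists (Num.max B B'); split => // [x xI|].
  by rewrite le_max hB.
exists (derive_on [set` I] g); first exact: derivable_on_deriv.
by apply: Cb_le C' => //; rewrite le_max lexx orbT.
Qed.

Lemma C_itvD k g1 g2 : C_itv a b k g1 -> C_itv a b k g2 ->
  C_itv a b k (fun x => g1 x + g2 x).
Proof.
move=> /C_itv_Cb[B1 C1] /C_itv_Cb[B2 C2].
exact: Cb_C_itv (CbD C1 C2).
Qed.

Lemma Cb_derive_itv k B g : Cb k B g ->
  forall x, x \in I -> `|derive_itv a b k g x| <= B.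
Proof.
elim: k g => [|k IH] g; first by case.
move=> [_ _ [g' hg' Cg']]; rewrite /derive_itv iterSr; apply: IH.
by apply: Cb_ext Cg' => x xI; rewrite (deriv_itvE ab hg').
Qed.

Lemma deriv_itv_cst (c : R) : deriv_itv a b (fun=> c) (fun=> 0).
Proof.
apply/deriv_itvP => x xI e e0; exists 1 => // y yI yx _.
by rewrite /quot subrr mul0r subrr normr0.
Qed.

Lemma deriv_itv_poly (P : {poly R}) :
  deriv_itv a b (fun x => P.[x]) (fun x => P^`().[x]).
Proof.
elim/poly_ind: P => [|P c IH].
  by rewrite deriv0; move: (deriv_itv_cst 0); congr deriv_itv; apply/funext => x; rewrite horner0.
have Did : deriv_itv a b id (fun=> 1).
  apply/deriv_itvP => x xI e e0; exists 1 => // y yI yx _.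
  by rewrite /quot divff ?subr_eq0 // subrr normr0.
have := deriv_itvD (deriv_itvM IH Did) (deriv_itv_cst c).
congr deriv_itv; apply/funext => x; rewrite !hornerE //.
by rewrite derivD derivM derivX derivC !hornerE.
Qed.

(** Induction on the order: the mean value theorem is applied to [g] minus its Taylor polynomial,
    whose derivative is the remainder of [g'] one order lower. Dropping the factorials keeps the
    same [B] for coefficients and remainder. *)
Lemma taylor k B g x0 : Cb k B g -> x0 \in I ->
  exists2 c : nat -> R, forall i, `|c i| <= B & forall x, x \in I ->
    `|g x - \sum_(i < k) c i * (x - x0) ^+ i| <= B * `|x - x0| ^+ k.
Proof.
move=> + x0I; elim: k g => [|k IH] g Cg; have B0 := Cb_ge0 Cg.
  exists (fun=> 0) => [i|x xI]; first by rewrite normr0.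
  by rewrite big_ord0 subr0 expr0 mulr1; apply: Cb_bound Cg _ xI.
have [_ hB [g' hg' /IH[c' c'B hc']]] := Cg.
(* The polynomial obtained for [g'] is integrated term by term, with constant term [g x0]. *)
pose c i := if i is j.+1 then c' j / j.+1%:R else g x0.
exists c => [[|i]|x xI] /=; first exact: hB.
  rewrite normrM normfV normr_nat ler_pdivrMr ?ltr0n //.
  by apply: le_trans (c'B i) _; rewrite ler_peMr // ler1n.
pose P : {poly R} := \sum_(i < k.+1) c i *: ('X - x0%:P) ^+ i.
have hP y : \sum_(i < k.+1) c i * (y - x0) ^+ i = P.[y].
  by rewrite horner_sum; apply: eq_bigr => i _; rewrite hornerZ horner_exp hornerXsubC.
have hP' y : P^`().[y] = \sum_(i < k) c' i * (y - x0) ^+ i.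
  rewrite /P big_ord_recl expr0 derivD linearZ /= derivC scaler0 add0r.
  rewrite raddf_sum /= horner_sum; apply: eq_bigr => i _.
  rewrite derivZ deriv_exp derivXsubC mul1r /= hornerZ hornerMn horner_exp hornerXsubC.
  by rewrite add0n /bump leq0n add1n mulrnAr -mulrnAl -[_ / _ *+ _]mulr_natr divfK // pnatr_eq0.
have D := deriv_itvD hg' (deriv_itvZ (c := -1) (@deriv_itv_poly P)).
have [z [zI zx]] := deriv_itv_MVT D x0I xI.
have P0 : P.[x0] = g x0.
  rewrite -hP big_ord_recl expr0 mulr1 big1 ?addr0 // => i _.
  by rewrite subrr expr0n mulr0.
rewrite P0 !mulN1r subrr subr0 hP => ->.
rewrite normrM exprSr mulrA ler_wpM2r // hP'.
apply: le_trans (hc' z zI) _; rewrite ler_wpM2l //.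
by rewrite lerXn2r ?nnegrE.
Qed.

End BoundedDerivatives.

(** * Derivatives of kernels along a curve, uniformly over families of evaluations *)

Section SmoothKernels.
Context {R : realType} (a b : R).
Local Notation I := `[a, b].
Implicit Type F : R -> R -> R -> R.

Lemma C_Omega_continuous k F : C_Omega a b k F -> continuous_Omega a b F.
Proof. by case: k => [|k] []. Qed.

Lemma C_Omega_le k k' F : (k' <= k)%N -> C_Omega a b k F -> C_Omega a b k' F.
Proof.
elim: k k' F => [|k IH] [|k'] F //= kk [cF]; first by split.
by move=> [h [C1 C2 C3]]; split=> //; split=> //; split; apply: IH.
Qed.

Lemma partial_u_is_derive F s t : has_partial_u a b F -> s \in I -> t \in I ->
  forall u : R, is_derive u 1 (F s t) (partial_u F s t u).
Proof.
move=> hF sI tI u; rewrite /partial_u derive1E.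
by apply: derivableP; apply: hF; split.
Qed.

Lemma line_MVT (g g' : R -> R) : (forall u : R, is_derive u 1 g (g' u)) ->
  forall u v, exists c, [/\ `|c - u| <= `|v - u|, `|c| <= Num.max `|u| `|v|
    & g v - g u = g' c * (v - u)].
Proof.
move=> dg.
have key u v : u <= v -> exists2 c, u <= c <= v & g v - g u = g' c * (v - u).
  move=> uv; have [|c cI hc] := @MVT_segment R g g' u v uv (fun z _ => dg z).
    apply: continuous_subspaceT => z.
    apply: differentiable_continuous; apply/derivable1_diffP.
    by have [] := dg z.
  by exists c => //; move: cI; rewrite in_itv.
have between (u v c : R) : u <= c <= v -> `|c| <= Num.max `|u| `|v|.
  move=> cuv; rewrite le_max ler_norml [X in _ || X]ler_norml.
  by case: (leP 0 u) => u0; case: (leP 0 v) => v0; case: (leP 0 c) => c0;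
     rewrite ?(ger0_norm u0) ?(ger0_norm v0) ?(ltr0_norm u0) ?(ltr0_norm v0);
     apply/orP; (left; lra) || (right; lra).
move=> u v; have [uv|vu] := leP u v.
  have [c cuv hc] := key u v uv; exists c; split => //; last exact: between.
  by rewrite !ger0_norm ?subr_ge0 //; lra.
have [c cuv hc] := key v u (ltW vu); exists c; split.
- by rewrite !ler0_norm ?subr_le0 //; lra.
- by rewrite maxC; apply: between.
- by rewrite -opprB hc; ring.
Qed.

(** Two successive mean values, one for [g] and one for [g']; this gives the constant [B] instead of
    [B / 2]. *)
Lemma line_taylor2 (g g' g'' : R -> R) (M B : R) :
  (forall u : R, is_derive u 1 g (g' u)) -> (forall u : R, is_derive u 1 g' (g'' u)) ->
  (forall u, `|u| <= M -> `|g'' u| <= B) -> forall u v, `|u| <= M -> `|v| <= M ->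
  `|g v - g u - g' u * (v - u)| <= B * `|v - u| ^+ 2.
Proof.
move=> dg dg' hB u v uM vM; have [c [cu cM ->]] := line_MVT dg u v.
have [c' [_ c'M]] := line_MVT dg' u c.
rewrite -mulrBl => ->; rewrite !normrM expr2 mulrA ler_wpM2r //.
rewrite ler_pM // hB //; apply: le_trans c'M _.
by rewrite ge_max uM (le_trans cM) // ge_max uM.
Qed.

Lemma partial_u_MVT F s t : has_partial_u a b F -> s \in I -> t \in I ->
  forall u v, exists c, [/\ `|c - u| <= `|v - u|, `|c| <= Num.max `|u| `|v|
    & F s t v - F s t u = partial_u F s t c * (v - u)].
Proof. by move=> hF sI tI; apply: line_MVT; apply: partial_u_is_derive. Qed.

Hypothesis ab : a < b.

Lemma C_Omega_slice k F M : C_Omega a b k F -> exists B, forall t u,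
  t \in I -> `|u| <= M -> Cb a b k B (fun s => F s t u).
Proof.
elim: k F => [|k IH] F.
  move=> /= [cF _]; have [B hB] := Omega_bounded cF M.
  exists B => t u tI uM; split => // [|s sI]; last exact: hB.
  apply/within_continuousP => s sI e e0.
  have [d d0 hd] := continuous_OmegaP cF u sI tI e0.
  by exists d => // s' s'I ss; apply: hd => //; rewrite subrr normr0.
move=> [cF [[hs _ _] [Cs _ _]]]; have [B1 hB1] := IH _ Cs.
have [B2 hB2] := Omega_bounded cF M.
exists (Num.max B1 B2) => t u tI uM.
have D : deriv_itv a b (fun s => F s t u) (fun s => partial_s a b F s t u).
  by apply: derivable_on_deriv => s sI; apply: hs; split.
split; first exact: deriv_itv_continuous D.
  by move=> s sI; rewrite le_max hB2 ?orbT.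
by exists (fun s => partial_s a b F s t u) => //; apply: Cb_le (hB1 t u tI uM);
  rewrite // le_max lexx.
Qed.

(** The increment is split into a step in [t] at fixed [u], then a step in [u] at fixed [t]. Each
    has a mean value point, [xi] or [eta], that tends to the base point, and continuity of the
    partial derivatives concludes. *)
Lemma deriv_itv_comp F (phi phi' : R -> R) s : C_Omega a b 1 F ->
  deriv_itv a b phi phi' -> s \in I ->
  deriv_itv a b (fun t => F s t (phi t))
    (fun t => partial_t a b F s t (phi t) + partial_u F s t (phi t) * phi' t).
Proof.
move=> /= [cF [[_ ht hu] [_ [cFt _] [cFu _]]]] Dphi sI.
have cphi := deriv_itv_continuous Dphi.
have DFt u : deriv_itv a b (fun t => F s t u) (fun t => partial_t a b F s t u).
  by apply: derivable_on_deriv => t tI; apply: ht; split.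
move=> x xI.
have /choice[xi hxi] y : exists c, y \in I ->
    [/\ c \in I, `|c - x| <= `|y - x|
      & F s y (phi y) - F s x (phi y) = partial_t a b F s c (phi y) * (y - x)].
  have [yI|] := boolP (y \in I); last by exists 0.
  by have [c hc] := deriv_itv_MVT (DFt (phi y)) xI yI; exists c.
have /choice[eta heta] y : exists c, `|c - phi x| <= `|phi y - phi x| /\
    F s x (phi y) - F s x (phi x) = partial_u F s x c * (phi y - phi x).
  by have [c [h1 _ h2]] := partial_u_MVT hu sI xI (phi x) (phi y); exists c.
have nb (P : R -> Prop) : (exists2 d : R, 0 < d & forall y, y \in I -> y != x ->
    `|y - x| < d -> P y) -> \forall y \near within [set` I] x^', P y.
  move=> [d d0 hd]; rewrite near_withinE; apply/nbhs_ballP; exists d => //= y yx xy yI.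
  by apply: hd => //; move: yx; rewrite /ball /= distrC.
have L1 : partial_t a b F s (xi y) (phi y) @[y --> within [set` I] x^']
    --> partial_t a b F s x (phi x).
  apply/cvgrPdist_lt => e e0; apply: nb.
  have [d d0 hd] := continuous_OmegaP cFt (phi x) sI xI e0.
  have /within_continuousP /(_ x xI d d0)[d' d'0 hd'] := cphi.
  exists (Num.min d d'); first by rewrite lt_min d0.
  move=> y yI yx; rewrite lt_min => /andP[yd yd'].
  have [cI cx _] := hxi y yI; apply: hd => //.
  - by rewrite subrr normr0.
  - exact: le_lt_trans yd.
  - by rewrite distrC; apply: hd'.
have L2 : partial_u F s x (eta y) @[y --> within [set` I] x^']
    --> partial_u F s x (phi x).
  apply/cvgrPdist_lt => e e0; apply: nb.
  have [d d0 hd] := continuous_OmegaP cFu (phi x) sI xI e0.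
  have /within_continuousP /(_ x xI d d0)[d' d'0 hd'] := cphi.
  exists d' => // y yI yx yd.
  have [cx _] := heta y; apply: hd => //; rewrite ?subrr ?normr0 //.
  by apply: le_lt_trans cx _; rewrite distrC; apply: hd'.
have L : partial_t a b F s (xi y) (phi y) + partial_u F s x (eta y) * quot phi x y
    @[y --> within [set` I] x^'] -->
    partial_t a b F s x (phi x) + partial_u F s x (phi x) * phi' x.
  by apply: cvgD => //; apply: cvgM => //; apply: Dphi.
apply/cvgrPdist_lt => e e0; have /cvgrPdist_lt /(_ e e0) := L.
rewrite !near_withinE => /nbhs_ballP[d /= d0 hd]; apply/nbhs_ballP.
exists d => //= y yd yx yI; have := hd y yd yx yI.
congr (`|_ - _| < _); have [_ _ h1] := hxi y yI; have [_ h2] := heta y.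
have yx0 : y - x != 0 by rewrite subr_eq0.
have E : quot (fun t => F s t (phi t)) x y =
    ((F s y (phi y) - F s x (phi y)) + (F s x (phi y) - F s x (phi x))) / (y - x).
  by rewrite /quot addrA subrK.
rewrite E h1 h2 mulrDl mulfK //; congr (_ + _).
by rewrite /quot mulrA.
Qed.

(* Finite linear combinations, in the first variable, of point evaluations. *)
Definition feval (S : seq (R * R)) F : R -> R -> R :=
  fun t u => \sum_(p <- S) p.1 * F p.2 t u.

(** If the family [V] is bounded on all kernels of class [r], it is bounded together with [k]
    derivatives in [t] on those of class [r + k]: differentiating along [phi] gives the same
    combination of [partial_t F] and [partial_u F], and the induction applies to these. The family
    is kept abstract for two uses: interpolation errors, and single evaluations with [r = 0]. *)
Lemma feval_Cb (V : set (seq (R * R))) (r : nat) :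
  (forall S, V S -> forall p, p \in S -> p.2 \in I) ->
  (forall F, C_Omega a b r F -> forall M : R, exists B : R, forall S t u, V S ->
     t \in I -> `|u| <= M -> `|feval S F t u| <= B) ->
  forall k F phi Bphi, C_Omega a b (r + k) F -> Cb a b k Bphi phi ->
  exists B, forall S, V S -> Cb a b k B (fun t => feval S F t (phi t)).
Proof.
move=> VI Vbd; elim=> [|k IH] F phi Bphi CF Cphi.
  rewrite addn0 in CF; have [B hB] := Vbd F CF Bphi.
  exists B => S VS; split => // [|t tI]; last by apply: hB => //; apply: Cb_bound Cphi _ tI.
  have cF := C_Omega_continuous CF; have cphi := Cb_continuous Cphi.
  have := VI S VS; rewrite /feval; elim: S {VS} => [|p S IHS] SI.
    apply: within_continuous_ext (_ : {within [set` I], continuous (fun=> 0)}).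
      by move=> t _; rewrite big_nil.
    by apply: continuous_subspaceT => t; apply: cvg_cst.
  apply: (@within_continuous_ext _ _ _ (fun t => p.1 * F p.2 t (phi t) +
     \sum_(p <- S) p.1 * F p.2 t (phi t))).
    by move=> t _; rewrite big_cons.
  apply: within_continuousD.
    apply: within_continuousM_itv; first by apply: continuous_subspaceT => t; apply: cvg_cst.
    by apply: continuous_Omega_sub => //; apply: SI; rewrite mem_head.
  by apply: IHS => p' p'S; apply: SI; rewrite in_cons p'S orbT.
have CF1 : C_Omega a b 1 F by apply: C_Omega_le CF; rewrite addnS.
have [B0 hB0] : exists B, forall S t u, V S -> t \in I -> `|u| <= Bphi ->
    `|feval S F t u| <= B by apply: Vbd; apply: C_Omega_le CF; rewrite leq_addr.
rewrite addnS in CF; have [cF [_ [_ Ct Cu]]] := CF.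
have [_ hphi [phi' Dphi Cphi']] := Cphi.
have Cphik := Cb_le (leqnSn k) (lexx Bphi) Cphi.
have [B1 hB1] := IH _ _ _ Ct Cphik.
have [B2 hB2] := IH _ _ _ Cu Cphik.
exists (Num.max B0 (B1 + 2 ^+ k * (B2 * Bphi))) => S VS.
have D : deriv_itv a b (fun t => feval S F t (phi t)) (fun t =>
    feval S (partial_t a b F) t (phi t) + feval S (partial_u F) t (phi t) * phi' t).
  have := VI S VS; rewrite /feval; elim: S {VS} => [|p S IHS] SI.
    have := @deriv_itv_cst _ a b 0; congr deriv_itv; apply/funext => t.
      by rewrite big_nil.
    by rewrite !big_nil mul0r addr0.
  have pI : p.2 \in I by apply: SI; rewrite mem_head.
  have SI' p' : p' \in S -> p'.2 \in I by move=> p'S; apply: SI; rewrite in_cons p'S orbT.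
  have := deriv_itvD (deriv_itvZ (c := p.1) (deriv_itv_comp CF1 Dphi pI)) (IHS SI').
  congr deriv_itv; apply/funext => t; rewrite !big_cons //.
  by ring.
split; first exact: deriv_itv_continuous D.
  by move=> t tI; rewrite le_max hB0 ?hphi.
exists (fun t => feval S (partial_t a b F) t (phi t) + feval S (partial_u F) t (phi t) * phi' t) => //.
apply: (@Cb_le _ _ _ k _ (B1 + 2 ^+ k * (B2 * Bphi))) => //.
  by rewrite le_max lexx orbT.
by apply: CbD; [apply: hB1|apply: CbM; [|apply: hB2|]].
Qed.

End SmoothKernels.

(** * Integrals *)

Section Grid.
Context {R : realType} (a b : R).
Hypothesis ab : a < b.
Local Notation I := `[a, b].

Lemma mesh_gt0 m : (0 < m)%N -> 0 < mesh a b m.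
Proof. by move=> m0; rewrite /mesh divr_gt0 ?subr_gt0 // ltr0n. Qed.

Lemma meshE m : (0 < m)%N -> m%:R * mesh a b m = b - a.
Proof. by move=> m0; rewrite /mesh mulrC divfK // pnatr_eq0 -lt0n. Qed.

Lemma grid0 m : grid a b m 0 = a.
Proof. by rewrite /grid mul0r addr0. Qed.

Lemma gridm m : (0 < m)%N -> grid a b m m = b.
Proof. by move=> m0; rewrite /grid meshE // addrC subrK. Qed.

Lemma gridS m k : grid a b m k.+1 = grid a b m k + mesh a b m.
Proof. by rewrite /grid -natr1 mulrDl mul1r addrA. Qed.

Lemma grid_le m j k : (0 < m)%N -> (j <= k)%N -> grid a b m j <= grid a b m k.
Proof.
by move=> m0 jk; rewrite lerD2l ler_wpM2r ?ler_nat // ltW // mesh_gt0.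
Qed.

Lemma piece_sub m k t : (k < m)%N -> t \in piece a b m k -> t \in I.
Proof.
move=> km; have m0 : (0 < m)%N by apply: leq_ltn_trans km.
rewrite !in_itv /= => /andP[h1 h2]; apply/andP; split.
  by apply: le_trans h1; rewrite -[leLHS](grid0 m); apply: grid_le.
by apply: le_trans h2 _; rewrite -[leRHS](gridm m0); apply: grid_le.
Qed.

Lemma piece_param m k x : (0 < m)%N -> 0 <= x <= 1 ->
  grid a b m k + x * mesh a b m \in piece a b m k.
Proof.
move=> m0 /andP[x0 x1]; have h0 := mesh_gt0 m0.
rewrite in_itv /= gridS lerDl mulr_ge0 ?(ltW h0) //= lerD2l.
by rewrite ler_piMl // ltW.
Qed.

Lemma pieceP m k t : (0 < m)%N -> t \in piece a b m k ->
  exists2 x, 0 <= x <= 1 & t = grid a b m k + x * mesh a b m.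
Proof.
move=> m0; have h0 := mesh_gt0 m0; rewrite in_itv /= gridS => /andP[h1 h2].
exists ((t - grid a b m k) / mesh a b m); last by rewrite divfK ?gt_eqF // addrC subrK.
rewrite divr_ge0 ?subr_ge0 ?(ltW h0) //= ler_pdivrMr // mul1r.
by rewrite lerBlDl.
Qed.

(** As the coarse mesh is [p] times the fine one, fine nodes get the reference coordinate
    [(l + mu i) / p] on their coarse piece, the one used by [mono_err_orthogonal]. *)
Lemma quad_nodeE rho (mu : 'I_rho -> R) n p k l i : (0 < n)%N -> (0 < p)%N ->
  quad_node mu a b (n * p) (k * p + l) i =
  grid a b n k + (l%:R + mu i) / p%:R * mesh a b n.
Proof.
move=> n0 p0; rewrite /quad_node /grid /mesh natrM natrD natrM.
have : n%:R != 0 :> R by rewrite pnatr_eq0 -lt0n.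
have : p%:R != 0 :> R by rewrite pnatr_eq0 -lt0n.
by move=> h1 h2; field; rewrite h1 h2.
Qed.

End Grid.

(** * Riemann sums, integrals with a parameter, almost everywhere equality *)

Section Integrals.
Context {R : realType} (a b : R).
Hypothesis ab : a < b.
Local Notation I := `[a, b].
Local Notation leb := (@lebesgue_measure R).

Lemma itv_integrable (g : R -> R) : {within [set` I], continuous g} ->
  leb.-integrable [set` I] (EFin \o g).
Proof. by move=> cg; apply: continuous_compact_integrable => //; apply: segment_compact. Qed.

Lemma itv_integral_le (g : R -> R) (B : R) : {within [set` I], continuous g} ->
  (forall t, t \in I -> `|g t| <= B) ->
  `|\int[leb]_(t in [set` I]) g t| <= B * (b - a).
Proof.
move=> cg hB; apply: le_trans (le_normr_Rintegral _ (itv_integrable cg)) _ => //.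
have <- : \int[leb]_(t in [set` I]) B = B * (b - a).
  by rewrite Rintegral_cst //= lebesgue_measure_itv /= lte_fin ab.
apply: le_Rintegral => //.
- apply: itv_integrable; apply/within_continuousP => x xI e e0.
  have /within_continuousP /(_ x xI e e0)[d d0 hd] := cg.
  exists d => // y yI yx; apply: le_lt_trans (hd y yI yx).
  exact: ler_dist_dist.
- by apply: itv_integrable; apply: continuous_subspaceT => t; apply: cvg_cst.
Qed.

Lemma itv_integralB (g1 g2 : R -> R) : {within [set` I], continuous g1} ->
  {within [set` I], continuous g2} ->
  \int[leb]_(t in [set` I]) (g1 t - g2 t) =
  \int[leb]_(t in [set` I]) g1 t - \int[leb]_(t in [set` I]) g2 t.
Proof. by move=> c1 c2; apply: RintegralB => //; apply: itv_integrable. Qed.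

Lemma itv_integralZ (c : R) (g : R -> R) : {within [set` I], continuous g} ->
  \int[leb]_(t in [set` I]) (c * g t) = c * \int[leb]_(t in [set` I]) g t.
Proof. by move=> cg; apply: RintegralZl => //; apply: itv_integrable. Qed.

(** The mean value theorem for the primitive, cell by cell: the integral is exactly a Riemann sum
    with well-chosen points. *)
Lemma integral_mean (g : R -> R) (m : nat) : {within [set` I], continuous g} ->
  (0 < m)%N -> exists2 c : nat -> R, forall j, (j < m)%N -> c j \in piece a b m j &
  \int[leb]_(t in [set` I]) g t = mesh a b m * \sum_(j < m) g (c j).
Proof.
move=> cg m0; pose G x := \int[leb]_(t in `[a, x]) g t.
have cG : {within [set` I], continuous G}.
  exact: parameterized_integral_continuous (ltW ab) (itv_integrable cg).
have dG x : x \in `]a, b[ -> is_derive x (1 : R) G (g x).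
  rewrite in_itv /= => /andP[ax xb].
  have cgx : {for x, continuous g}.
    have /within_continuousP c := cg; apply/cvgrPdist_lt => e e0.
    have [|d d0 hd] := c x _ e e0; first by rewrite in_itv /= !ltW.
    apply/nbhs_ballP; exists (Num.min d (Num.min (x - a) (b - x))) => /=.
      by rewrite !lt_min d0 !subr_gt0 ax.
    move=> y; rewrite /ball /= !lt_min => /and3P[h1 h2 h3].
    apply: hd; last by rewrite distrC.
    by move: h2 h3; rewrite !ltr_norml in_itv /=; lra.
  have [d1 d2] := @continuous_FTC1_closed R g a x b xb (itv_integrable cg) ax cgx.
  by have := derivableP d1; rewrite -derive1E d2.
have Ga : G a = 0 by rewrite /G set_itv1 Rintegral_set1.
rewrite -/(G b); clearbody G.
have /choice[c hc] (j : nat) : exists c, (j < m)%N -> c \in piece a b m j /\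
    G (grid a b m j.+1) - G (grid a b m j) = g c * mesh a b m.
  have [jm|] := ltnP j m; last by exists 0.
  have le1 := grid_le ab m0 (leqnSn j).
  have h1 : a <= grid a b m j by rewrite -[leLHS](grid0 a b m); apply: grid_le.
  have h2 : grid a b m j.+1 <= b by rewrite -[leRHS](gridm a b m0); apply: grid_le.
  have dGj x : x \in `]grid a b m j, grid a b m j.+1[ -> is_derive x (1 : R) G (g x).
    rewrite in_itv /= => /andP[x1 x2]; apply: dG.
    by rewrite in_itv /= (le_lt_trans h1) //= (lt_le_trans x2).
  have cGj : {within [set` `[grid a b m j, grid a b m j.+1]], continuous G}.
    apply: (@continuous_subspaceW _ _ _ [set` I]) cG => x /=.
    rewrite !in_itv /= => /andP[x1 x2].
    by rewrite (le_trans h1) //= (le_trans x2).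
  have [c cI hc] := @MVT_segment R G g _ _ le1 dGj cGj.
  by exists c; split => //; rewrite hc gridS addrAC subrr add0r.
exists c => [j jm|]; first by have [] := hc j jm.
transitivity (G (grid a b m m) - G (grid a b m 0)).
  by rewrite gridm // grid0 Ga subr0.
rewrite -(telescope_sumr (fun j => G (grid a b m j)) (leq0n m)) big_mkord mulr_sumr; apply: eq_bigr => j _.
by have [_ ->] := hc j (ltn_ord j); rewrite mulrC.
Qed.

(** For functions that are merely continuous, as the limits produced by compactness. Since the
    weights sum to 1, the sample at [c j] can be compared with each node of its cell, by uniform
    continuity; signed weights enter through their absolute values. *)
Lemma composite_cvg rho (w mu : 'I_rho -> R) (g : R -> R) :
  (forall i, 0 <= mu i <= 1) -> \sum_i w i = 1 ->
  {within [set` I], continuous g} -> forall e : R, 0 < e -> exists N, forall m,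
  (0 < m)%N -> (N <= m)%N ->
  `|\int[leb]_(t in [set` I]) g t - composite w mu a b m g| <= e.
Proof.
move=> hmu w1 cg e e0; pose W := \sum_i `|w i| + 1.
have W0 : 0 < W by rewrite ltr_wpDl // sumr_ge0.
have ba0 : 0 < b - a by rewrite subr_gt0.
have e'0 : 0 < e / (W * (b - a)) by rewrite divr_gt0 // mulr_gt0.
have [d d0 hd] := within_unif cg e'0.
exists (Num.bound ((b - a) / d)).+1 => m m0 Nm.
have [c cI ->] := integral_mean cg m0.
have md : mesh a b m < d.
  rewrite /mesh ltr_pdivrMr ?ltr0n // mulrC -ltr_pdivrMr //.
  apply: lt_le_trans (_ : (Num.bound ((b - a) / d))%:R <= _).
    by apply: archi_boundP; rewrite divr_ge0 // ltW.
  by rewrite ler_nat; apply: ltnW.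
rewrite /composite -mulrBr -sumrB normrM gtr0_norm ?mesh_gt0 //.
apply: le_trans (_ : mesh a b m * (\sum_(j < m) e / (b - a)) <= _).
  rewrite ler_wpM2l ?(ltW (mesh_gt0 _ _)) //.
  apply: le_trans (ler_norm_sum _ _ _) _; apply: ler_sum => j _.
  rewrite -[g (c j)]mul1r -w1 mulr_suml -sumrB.
  apply: le_trans (ler_norm_sum _ _ _) _.
  apply: le_trans (_ : \sum_i `|w i| * (e / (W * (b - a))) <= _).
    apply: ler_sum => i _; rewrite -mulrBr normrM ler_wpM2l // ltW //.
    have cj := cI j (ltn_ord j).
    have zj : quad_node mu a b m j i \in piece a b m j by apply: piece_param.
    apply: hd; rewrite ?(piece_sub ab (ltn_ord j)) //.
    apply: le_lt_trans md; move: cj zj; rewrite !in_itv /= gridS.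
    by rewrite ler_norml; lra.
  rewrite -mulr_suml -[leRHS]mulr1.
  have -> : e / (W * (b - a)) = e / (b - a) / W by field; rewrite !gt_eqF.
  rewrite mulrCA ler_wpM2l ?divr_ge0 ?(ltW e0) ?(ltW ba0) //.
  by rewrite ler_pdivrMr // mul1r /W lerDl.
rewrite sumr_const card_ord -mulr_natl mulrA [mesh _ _ _ * _]mulrC meshE //.
by rewrite mulrC divfK // gt_eqF.
Qed.

(** The difference quotient of the integrand is a value of [partial_s F] at an intermediate point,
    uniformly close in [t] to its value at [x]. *)
Lemma deriv_itv_integral (F : R -> R -> R -> R) (phi : R -> R) :
  C_Omega a b 1 F -> {within [set` I], continuous phi} ->
  deriv_itv a b (fun s => \int[leb]_(t in [set` I]) F s t (phi t))
    (fun s => \int[leb]_(t in [set` I]) partial_s a b F s t (phi t)).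
Proof.
move=> [cF [[hs _ _] [[cFs _] _ _]]] cphi; apply/deriv_itvP => x xI e e0.
have [M hM] := within_bounded cphi.
have ba0 : 0 < b - a by rewrite subr_gt0.
have e'0 : 0 < e / 2 / (b - a) by rewrite !divr_gt0.
have [d d0 hd] := Omega_unif cFs M e'0.
exists d => // y yI yx yd.
have yx0 : y - x != 0 by rewrite subr_eq0.
have cont G s : continuous_Omega a b G -> s \in I ->
    {within [set` I], continuous (fun t => G s t (phi t))}.
  by move=> cG sI; apply: continuous_Omega_sub.
have cQ : {within [set` I], continuous (fun t => (y - x)^-1 * (F y t (phi t) - F x t (phi t)))}.
  apply: within_continuousM_itv; first by apply: continuous_subspaceT => t; apply: cvg_cst.
  by apply: within_continuousB; apply: cont.
have -> : quot (fun s => \int[leb]_(t in [set` I]) F s t (phi t)) x y =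
    \int[leb]_(t in [set` I]) ((y - x)^-1 * (F y t (phi t) - F x t (phi t))).
  rewrite itv_integralZ; last by apply: within_continuousB; apply: cont.
  by rewrite itv_integralB; [rewrite /quot mulrC|exact: cont..].
rewrite -itv_integralB //; last exact: cont.
apply: le_lt_trans (_ : e / 2 / (b - a) * (b - a) < e); last first.
  by rewrite divfK ?gt_eqF //; lra.
apply: itv_integral_le; first by apply: within_continuousB => //; apply: cont.
move=> t tI.
have D : deriv_itv a b (fun s => F s t (phi t)) (fun s => partial_s a b F s t (phi t)).
  by apply: derivable_on_deriv => s sI; apply: hs; split.
have [c [cI cx ->]] := deriv_itv_MVT D xI yI.
rewrite mulrC mulfK //; apply: ltW; apply: hd; rewrite ?hM ?subrr ?normr0 //.
exact: le_lt_trans yd.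
Qed.

Lemma C_itv_integral k (F : R -> R -> R -> R) (phi : R -> R) :
  C_Omega a b k F -> {within [set` I], continuous phi} ->
  C_itv a b k (fun s => \int[leb]_(t in [set` I]) F s t (phi t)).
Proof.
move=> + cphi; elim: k F => [|k IH] F.
  move=> [cF _]; split => //; apply/within_continuousP => x xI e e0.
  have [M hM] := within_bounded cphi.
  have ba0 : 0 < b - a by rewrite subr_gt0.
  have e'0 : 0 < e / 2 / (b - a) by rewrite !divr_gt0.
  have [d d0 hd] := Omega_unif cF M e'0.
  have cont s : s \in I -> {within [set` I], continuous (fun t => F s t (phi t))}.
    by move=> sI; apply: continuous_Omega_sub.
  exists d => // y yI yd; rewrite -itv_integralB; [|exact: cont..].
  apply: le_lt_trans (_ : e / 2 / (b - a) * (b - a) < e); last first.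
    by rewrite divfK ?gt_eqF //; lra.
  apply: itv_integral_le; first by apply: within_continuousB; apply: cont.
  by move=> t tI; apply: ltW; apply: hd; rewrite ?hM ?subrr ?normr0.
move=> CF; have [_ [_ [Cs _ _]]] := CF.
by apply: (C_itvS ab (deriv_itv_integral (C_Omega_le _ CF) cphi)) => //; apply: IH.
Qed.

(** A difference at one point persists on a nondegenerate interval, of positive measure. This turns
    the almost everywhere statements on solutions into pointwise ones. *)
Lemma ae_itv_eq (x y : R -> R) : {within [set` I], continuous x} ->
  {within [set` I], continuous y} -> ae_itv a b (fun t => x t = y t) ->
  {in I, x =1 y}.
Proof.
move=> cx cy xy t0 t0I; apply/eqP/negPn/negP => neq.
have /within_continuousP c := within_continuousB cx cy.
have n0 : 0 < `|x t0 - y t0| by rewrite normr_gt0 subr_eq0.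
have [d d0 hd] := c t0 t0I _ n0.
pose lo := Num.max a (t0 - d / 2); pose hi := Num.min b (t0 + d / 2).
have lohi : lo < hi.
  move: t0I; rewrite in_itv /= /lo /hi gt_max !lt_min ab => /andP[h1 h2] /=.
  by apply/andP; split; [|apply/andP; split]; lra.
have sub : [set` `[lo, hi]] `<=` ~` [set t | t \in I -> x t = y t].
  move=> t; rewrite /= in_itv /= /lo /hi ge_max !le_min => /andP[/andP[h1 h2] /andP[h3 h4]] h.
  have tI : t \in I by rewrite in_itv /= h1.
  have := hd t tI; rewrite ltr_norml => /(_ ltac:(lra)).
  by rewrite -[(x - y) t]/(x t - y t) (h tI) subrr subr0 ltxx.
have [B [mB B0 sB]] := xy.
have sub' : [set` `[lo, hi]] `<=` B by move=> t /sub; apply: sB.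
have B0' : leb B = 0%E := B0.
have L := le_measure leb (mem_set (measurable_itv `[lo, hi])) (mem_set mB) sub'.
have {L} : (leb [set` `[lo, hi]] <= leb B)%E by exact L.
by rewrite B0' lebesgue_measure_itv /= lte_fin lohi -EFinD lee_fin subr_le0 leNgt lohi.
Qed.

Lemma Linfty_continuous (x : R -> R) : {within [set` I], continuous x} -> Linfty a b x.
Proof.
move=> cx; split.
  by apply/measurable_EFinP; apply: measurable_int (itv_integrable cx).
have [M hM] := within_bounded cx; exists M.
by apply: aeW => t; apply: hM.
Qed.

End Integrals.

(** * Discrete integrals and compactness *)

Section DiscreteIntegral.
Context {R : realType} (a b : R).
Hypothesis ab : a < b.
Local Notation I := `[a, b].
Variables (rho : nat) (w mu : 'I_rho -> R).
Hypothesis hmu : forall i, 0 <= mu i <= 1.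

(** The linear functional behind [nystrom]: at [s], the latter is by conversion [dint] of the
    integrand [kappa s t (x k t)]. Linear combinations of integrands can then be formed under one
    symbol. *)
Definition dint (n p : nat) (x : pwfun R) : R :=
  mesh a b (n * p) * \sum_(j < n * p) \sum_(i < rho)
    w i * x (j %/ p)%N (quad_node mu a b (n * p) j i).

Let W := \sum_i `|w i|.

Lemma wsum_ge0 : 0 <= W. Proof. exact: sumr_ge0. Qed.

Lemma refined_node (p l : nat) (i : 'I_rho) : (l < p)%N ->
  0 <= (l%:R + mu i) / p%:R <= 1.
Proof.
move=> lp; have p0 : 0 < p%:R :> R by rewrite ltr0n (leq_ltn_trans _ lp).
have /andP[h1 h2] := hmu i.
rewrite divr_ge0 ?addr_ge0 ?(ltW p0) //= ler_pdivrMr // mul1r.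
apply: le_trans (_ : l.+1%:R <= _); last by rewrite ler_nat.
by rewrite -natr1 lerD2l.
Qed.

Lemma quad_node_piece n p j i : (j < n * p)%N ->
  (j %/ p < n)%N /\ quad_node mu a b (n * p) j i \in piece a b n (j %/ p).
Proof.
move=> jnp; have np0 : (0 < n * p)%N by apply: leq_ltn_trans jnp.
have /andP[n0 p0] : (0 < n)%N && (0 < p)%N by rewrite -muln_gt0.
split; first by rewrite ltn_divLR.
rewrite {1}(divn_eq j p) quad_nodeE //; apply: piece_param => //.
by apply: refined_node; rewrite ltn_mod.
Qed.

Lemma dint_le n p x B : (0 < n)%N -> (0 < p)%N ->
  (forall k t, (k < n)%N -> t \in piece a b n k -> `|x k t| <= B) ->
  `|dint n p x| <= (b - a) * W * B.
Proof.
move=> n0 p0 hB; have np0 : (0 < n * p)%N by rewrite muln_gt0 n0.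
have -> : (b - a) * W * B = mesh a b (n * p) * ((n * p)%:R * (W * B)).
  by rewrite -(meshE a b np0); ring.
rewrite /dint normrM gtr0_norm ?mesh_gt0 //.
rewrite ler_wpM2l ?(ltW (mesh_gt0 _ _)) //.
apply: le_trans (ler_norm_sum _ _ _) _.
apply: le_trans (_ : \sum_(j < n * p) W * B <= _); last first.
  by rewrite sumr_const card_ord mulr_natl.
apply: ler_sum => j _; apply: le_trans (ler_norm_sum _ _ _) _.
rewrite /W mulr_suml; apply: ler_sum => i _; rewrite normrM ler_wpM2l //.
by have [h1 h2] := quad_node_piece i (ltn_ord j); apply: hB.
Qed.

Lemma dintB n p x y : dint n p x - dint n p y = dint n p (fun k t => x k t - y k t).
Proof.
rewrite /dint -mulrBr -sumrB; congr (_ * _); apply: eq_bigr => j _.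
by rewrite -sumrB; apply: eq_bigr => i _; rewrite mulrBr.
Qed.

Lemma dintD n p x y : dint n p x + dint n p y = dint n p (fun k t => x k t + y k t).
Proof.
rewrite /dint -mulrDr -big_split; congr (_ * _); apply: eq_bigr => j _.
by rewrite -big_split; apply: eq_bigr => i _; rewrite mulrDr.
Qed.

Lemma dintZ n p c x : c * dint n p x = dint n p (fun k t => c * x k t).
Proof.
rewrite /dint mulrCA mulr_sumr; congr (_ * _); apply: eq_bigr => j _.
by rewrite mulr_sumr; apply: eq_bigr => i _; rewrite mulrCA.
Qed.

Lemma sum_blocks (n p : nat) (F : nat -> R) :
  \sum_(j < n * p) F j = \sum_(k < n) \sum_(l < p) F (k * p + l)%N.
Proof.
elim: n => [|n IH]; first by rewrite mul0n !big_ord0.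
rewrite mulSnr big_split_ord big_ord_recr /= -IH; congr (_ + _).
Qed.

(** The fine sum is regrouped by coarse pieces, each contributing the coarse mesh times a mean over
    its [p] cells; orthogonality holds piece by piece. *)
Lemma dint_pieces n p x : (0 < n)%N -> (0 < p)%N -> dint n p x =
  \sum_(k < n) mesh a b n * (p%:R^-1 * \sum_(l < p) \sum_(i < rho)
    w i * x k (grid a b n k + (l%:R + mu i) / p%:R * mesh a b n)).
Proof.
move=> n0 p0; have p0R : p%:R != 0 :> R by rewrite pnatr_eq0 -lt0n.
have n0R : n%:R != 0 :> R by rewrite pnatr_eq0 -lt0n.
rewrite /dint (@sum_blocks n p (fun j => \sum_(i < rho)
    w i * x (j %/ p)%N (quad_node mu a b (n * p) j i))).
rewrite mulr_sumr; apply: eq_bigr => k _; rewrite mulrA; congr (_ * _).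
  by rewrite /mesh natrM; field; rewrite p0R n0R.
apply: eq_bigr => l _; apply: eq_bigr => i _.
by rewrite divnMDl // divn_small // addn0 quad_nodeE.
Qed.

Hypothesis w1 : \sum_i w i = 1.

(* The functions [f + nystrom (x j)] are equicontinuous, so along an ultrafilter
   their pointwise limit is a uniform one; no subsequences are needed. *)
Lemma nystrom_compactness (kappa : R -> R -> R -> R) (f : R -> R)
    (n p : nat -> nat) (x : nat -> pwfun R) (M : R) (eta : nat -> R) :
  continuous_Omega a b kappa -> {within [set` I], continuous f} ->
  (forall j, (j < n j)%N) -> (forall j, (0 < p j)%N) ->
  (forall j k t, (k < n j)%N -> t \in piece a b (n j) k -> `|x j k t| <= M) ->
  (forall j k t, (k < n j)%N -> t \in piece a b (n j) k ->
     `|x j k t - f t - nystrom a b w mu kappa (n j) (p j) (x j) t| <= eta j) ->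
  (forall e : R, 0 < e -> exists N, forall j, (N <= j)%N -> eta j <= e) ->
  exists X : R -> R, [/\ {within [set` I], continuous X},
    forall s, s \in I ->
      X s = f s + \int[lebesgue_measure]_(t in [set` I]) kappa s t (X t) &
    forall e : R, 0 < e -> forall N, exists2 j, (N <= j)%N & forall k t,
      (k < n j)%N -> t \in piece a b (n j) k -> `|x j k t - X t| <= e].
Proof.
move=> ck cf nj pj xM xeta eta0.
have n0 j : (0 < n j)%N by apply: leq_ltn_trans (nj j).
have ba0 : 0 < b - a by rewrite subr_gt0.
have bW0 : 0 < (b - a) * W + 1 by rewrite ltr_wpDl // mulr_ge0 ?wsum_ge0 // ltW.
pose y j s := f s + nystrom a b w mu kappa (n j) (p j) (x j) s.
have [Mf hMf] := within_bounded cf.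
have [Mk hMk] := Omega_bounded ck M.
pose My := Mf + (b - a) * W * Mk.
have yM j s : s \in I -> `|y j s| <= My.
  move=> sI; apply: le_trans (ler_normD _ _) _; apply: lerD; first exact: hMf.
  apply: (@dint_le (n j) (p j) (fun k t => kappa s t (x j k t))) => // k t kn tk.
  by apply: hMk; rewrite ?xM //; apply: piece_sub tk.
have equi (e : R) : 0 < e -> exists2 d : R, 0 < d & forall j s s', s \in I -> s' \in I ->
    `|s' - s| < d -> `|y j s - y j s'| <= e.
  move=> e0; have e20 : 0 < e / 2 by rewrite divr_gt0.
  have e30 : 0 < e / 2 / ((b - a) * W + 1) by rewrite divr_gt0.
  have [d d0 hd] := within_unif cf e20.
  have [d' d'0 hd'] := Omega_unif ck M e30.
  exists (Num.min d d'); first by rewrite lt_min d0.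
  move=> j s s' sI s'I; rewrite lt_min => /andP[h1 h2].
  have -> : y j s - y j s' = (f s - f s') +
     (dint (n j) (p j) (fun k t => kappa s t (x j k t)) -
      dint (n j) (p j) (fun k t => kappa s' t (x j k t))).
    by rewrite /y /dint /nystrom; ring.
  apply: le_trans (ler_normD _ _) _; rewrite [leRHS]splitr lerD //.
    by apply: ltW; apply: hd.
  rewrite dintB; apply: le_trans (_ : (b - a) * W * (e / 2 / ((b - a) * W + 1)) <= _).
    apply: dint_le => // k t kn tk; have tI := piece_sub ab kn tk.
    by apply: ltW; apply: hd'; rewrite ?subrr ?normr0 ?xM.
  rewrite mulrCA -[leRHS]mulr1 ler_wpM2l ?(ltW e20) //.
  by rewrite ler_pdivrMr // mul1r lerDl.
have [U UU lateU] := exists_ultra_late.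
have /choice[X hX] s : exists l, s \in I -> `|l| <= My /\
    forall e : R, 0 < e -> U [set j | `|l - y j s| < e].
  have [sI|] := boolP (s \in I); last by exists 0.
  have [|l lM hl] := @ultra_lim R U (fun j => y j s) (- My) My UU.
    by apply: filterS filterT => j _; have := yM j s sI; rewrite ler_norml.
  by exists l => _; split => //; rewrite ler_norml.
have Xequi (e : R) : 0 < e -> exists2 d : R, 0 < d & forall s s', s \in I -> s' \in I ->
    `|s' - s| < d -> `|X s - X s'| < e.
  move=> e0; have e40 : 0 < e / 4 by rewrite divr_gt0.
  have [d d0 hd] := equi _ e40; exists d => // s s' sI s'I ss.
  have [_ /(_ _ e40) h1] := hX s sI; have [_ /(_ _ e40) h2] := hX s' s'I.
  have [j [/= {}h1 {}h2]] := filter_ex (filterI h1 h2).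
  have := hd j s s' sI s'I ss; move: h1 h2.
  by rewrite !ltr_norml ler_norml; lra.
have cX : {within [set` I], continuous X}.
  apply/within_continuousP => s sI e e0; have [d d0 hd] := Xequi e e0.
  by exists d => // s' s'I; apply: hd.
(* Uniform convergence along [U]: otherwise bad points accumulate somewhere. *)
have unif (e : R) : 0 < e -> U [set j | forall s, s \in I -> `|X s - y j s| <= e].
  move=> e0; have [//|nU] := in_ultra_setVsetC
    [set j | forall s, s \in I -> `|X s - y j s| <= e] UU.
  have /choice[s hs] j : exists s, s \in I /\
      ((~` [set j | forall s, s \in I -> `|X s - y j s| <= e]) j -> e < `|X s - y j s|).
    have [h|] := pselect (forall s, s \in I -> `|X s - y j s| <= e).
      by exists a; split; [apply: left_in_itv|move=> /(_ h)].
    move=> /existsNP[s /not_implyP[sI h]]; exists s; split => // _.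
    by rewrite ltNge; apply/negP.
  have [|s0 s0I hs0] := @ultra_lim R U s a b UU.
    by apply: filterS filterT => j _; have [+ _] := hs j; rewrite in_itv.
  have s0I' : s0 \in I by rewrite in_itv.
  have e40 : 0 < e / 4 by rewrite divr_gt0.
  have [d d0 hd] := equi _ e40; have [d' d'0 hd'] := Xequi _ e40.
  have [_ /(_ _ e40) h0] := hX s0 s0I'.
  have [j [[[/= h1 h2] h3] h4]] :=
    filter_ex (filterI (filterI (filterI (hs0 _ d0) (hs0 _ d'0)) h0) nU).
  have [sI /(_ h4)] := hs j; rewrite ltNge => /negP[].
  have := hd j _ _ sI s0I' h1; have := hd' _ _ sI s0I' h2; move: h3.
  by rewrite !ltr_norml !ler_norml; lra.
have conv (e : R) : 0 < e -> U [set j | forall k t, (k < n j)%N ->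
    t \in piece a b (n j) k -> `|x j k t - X t| <= e].
  move=> e0; have e20 : 0 < e / 2 by rewrite divr_gt0.
  have [N hN] := eta0 _ e20.
  apply: filterS (filterI (unif _ e20) (lateU N)) => j [/= h1 h2] k t kn tk.
  have := h1 t (piece_sub ab kn tk); have := xeta j k t kn tk; have := hN j h2.
  rewrite /y; move: (nystrom _ _ _ _ _ _ _ _ _) => z.
  by rewrite !ler_norml; lra.
exists X; split=> //.
- move=> s sI; apply/eqP; rewrite -subr_eq0 -normr_le0; apply/ler_addgt0Pl => e e0.
  rewrite addr0; have e40 : 0 < e / 4 by rewrite divr_gt0.
  have cg := continuous_Omega_sub ck cX sI.
  have [N hN] := composite_cvg ab hmu w1 cg e40.
  have e50 : 0 < e / 4 / ((b - a) * W + 1) by rewrite divr_gt0.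
  (* [M] bounds the values of [x j], and [My] those of the limit [X]. *)
  have [d d0 hd] := Omega_unif ck (Num.max M My) e50.
  have d20 : 0 < d / 2 by rewrite divr_gt0.
  have [_ /(_ _ e40) h0] := hX s sI.
  have [j [[/= h1 h2] h3]] := filter_ex (filterI (filterI h0 (conv _ d20)) (lateU N)).
  have np0 : (0 < n j * p j)%N by rewrite muln_gt0 n0 pj.
  (* Since [j < n j], a late index refines the fine mesh whatever [p j] is. *)
  have Nnp : (N <= n j * p j)%N.
    apply: leq_trans h3 _; apply: leq_trans (ltnW (nj j)) _; exact: leq_pmulr.
  have := hN _ np0 Nnp; move: h1; rewrite /y.
  have : `|dint (n j) (p j) (fun k t => kappa s t (x j k t)) -
      dint (n j) (p j) (fun k t => kappa s t (X t))| <= e / 4.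
    rewrite dintB; apply: le_trans (_ : (b - a) * W * (e / 4 / ((b - a) * W + 1)) <= _).
      apply: dint_le => // k t kn tk; have tI := piece_sub ab kn tk.
      have [XM _] := hX t tI.
      apply: ltW; apply: hd; rewrite ?subrr ?normr0 ?le_max ?xM ?XM ?orbT //.
      by rewrite distrC; apply: le_lt_trans (h2 k t kn tk) _; lra.
    rewrite mulrCA -[leRHS]mulr1 ler_wpM2l ?(ltW e40) //.
    by rewrite ler_pdivrMr // mul1r lerDl.
  rewrite -[nystrom _ _ _ _ _ _ _ _ _]/(dint (n j) (p j) (fun k t => kappa s t (x j k t))).
  rewrite -[composite _ _ _ _ _ _]/(dint (n j) (p j) (fun k t => kappa s t (X t))).
  move: (dint _ _ _) (dint _ _ _) (\int[_]_(_ in _) _) => u1 u2 u3.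
  by rewrite !ltr_norml !ler_norml; lra.
- by move=> e e0 N; have [j [h1 h2]] := filter_ex (filterI (conv e e0) (lateU N)); exists j.
Qed.

End DiscreteIntegral.

(** * Interpolation at the Gauss points *)

Section Interpolation.
Context {R : realType} (a b : R).
Hypothesis ab : a < b.
Local Notation I := `[a, b].
Variables (r : nat) (q : 'I_r -> R).
Hypothesis q_inj : injective q.
Hypothesis q01 : forall i, 0 < q i < 1.

Lemma coll_node_piece n k i : (0 < n)%N -> coll_node a b q n k i \in piece a b n k.
Proof. by move=> n0; apply: piece_param => //; have /andP[] := q01 i => *; rewrite !ltW. Qed.

Lemma gridK n k y : grid a b n k + y - grid a b n k = y.
Proof. by rewrite addrC addKr. Qed.

Lemma local_coord n k y : (0 < n)%N ->
  (grid a b n k + y * mesh a b n - grid a b n k) / mesh a b n = y.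
Proof. by move=> n0; rewrite gridK mulfK // gt_eqF // mesh_gt0. Qed.

(** The Lagrange combination [P] shows that the set from which [xget] chooses is inhabited, so the
    default 0 is excluded; two of its members differ by a polynomial of size at most [r] with [r]
    distinct roots, hence coincide. *)
Lemma QnE n x k t : (0 < n)%N -> Qn a b q n x k t =
  \sum_i (lag q i).[(t - grid a b n k) / mesh a b n] * x k (coll_node a b q n k i).
Proof.
move=> n0; have h0 := mesh_gt0 ab n0.
have node_inj : injective (coll_node a b q n k).
  by move=> i j /addrI /mulIf; rewrite gt_eqF // => /(_ isT) /q_inj.
pose L : {poly R} := (mesh a b n)^-1 *: ('X + (- grid a b n k)%:P).
have sL : size L = 2%N by rewrite size_scale ?invr_eq0 ?gt_eqF // size_XaddC.
have hL s : L.[s] = (s - grid a b n k) / mesh a b n by rewrite !hornerE mulrC.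
pose P : {poly R} := \sum_i x k (coll_node a b q n k i) *: (lag q i \Po L).
have PE s : P.[s] =
    \sum_i (lag q i).[(s - grid a b n k) / mesh a b n] * x k (coll_node a b q n k i).
  rewrite horner_sum; apply: eq_bigr => i _.
  by rewrite hornerZ horner_comp hL mulrC.
have hP : [set P : {poly R} | (size P <= r)%N /\ forall i,
    P.[coll_node a b q n k i] = x k (coll_node a b q n k i)] P.
  split.
    apply: (big_ind (fun p : {poly R} => (size p <= r)%N)).
    - by rewrite size_poly0.
    - by move=> u v hu hv; apply: leq_trans (size_polyD _ _) _; rewrite geq_max hu.
    - move=> i _; apply: leq_trans (size_scale_leq _ _) _.
      by rewrite size_comp_poly2 // size_lag.
  move=> i; rewrite PE (bigD1 i) //= big1 => [|j ji].
    by rewrite /coll_node local_coord // lag_node // eqxx mul1r addr0.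
  by rewrite [X in (X - _) / _]/coll_node local_coord // lag_node // (negbTE ji) mul0r.
rewrite -PE /Qn /interp; congr _.[t].
have [s1 h1] := xgetI 0 hP; have [s2 h2] := hP.
set P1 := xget _ _ in s1 h1 *.
apply/eqP; rewrite -subr_eq0; apply/eqP.
have [S hS sS] : exists2 S, P1 - P = S * nodal (coll_node a b q n k) &
    (size S <= size (P1 - P)%R - r)%N.
  by apply: nodal_dvd => // i; rewrite /root !hornerE h1 h2 subrr.
suff S0 : S = 0 by rewrite hS S0 mul0r.
apply/eqP; rewrite -size_poly_eq0 -leqn0; apply: leq_trans sS _.
rewrite leqn0 subn_eq0; apply: leq_trans (size_polyD _ _) _.
by rewrite size_polyN geq_max s1.
Qed.

(* [Lam] bounds the Lebesgue constant of the interpolation, uniformly in [n]. *)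
Definition Lam : R := \sum_i \sum_(j < size (lag q i)) `|(lag q i)`_j|.

Lemma Lam_ge0 : 0 <= Lam.
Proof. by apply: sumr_ge0 => i _; apply: sumr_ge0. Qed.

Lemma lag_sum_le (x B : R) (y : 'I_r -> R) : 0 <= x <= 1 -> (forall i, `|y i| <= B) ->
  `|\sum_i (lag q i).[x] * y i| <= Lam * B.
Proof.
move=> /andP[x0 x1] hy; apply: le_trans (ler_norm_sum _ _ _) _.
rewrite /Lam mulr_suml; apply: ler_sum => i _.
rewrite normrM ler_pM // horner_coef; apply: le_trans (ler_norm_sum _ _ _) _.
apply: ler_sum => j _; rewrite normrM ler_piMr // normrX ger0_norm //.
by rewrite exprn_ile1.
Qed.

Lemma Qn_le n x k B t : (0 < n)%N -> t \in piece a b n k ->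
  (forall t, t \in piece a b n k -> `|x k t| <= B) -> `|Qn a b q n x k t| <= Lam * B.
Proof.
move=> n0 tk hB; rewrite QnE //; have [y y01 ->] := pieceP ab n0 tk.
rewrite local_coord //.
by apply: lag_sum_le => // i; apply: hB; apply: coll_node_piece.
Qed.

Lemma QnB n x y k t : (0 < n)%N ->
  Qn a b q n x k t - Qn a b q n y k t = Qn a b q n (fun k t => x k t - y k t) k t.
Proof.
by move=> n0; rewrite !QnE // -sumrB; apply: eq_bigr => i _; rewrite mulrBr.
Qed.

Lemma taylor_piece n k j B g : (0 < n)%N -> (k < n)%N -> Cb a b j B g ->
  exists2 c : nat -> R, forall i, `|c i| <= B & forall x, 0 <= x <= 1 ->
    `|g (grid a b n k + x * mesh a b n) - \sum_(i < j) c i * mesh a b n ^+ i * x ^+ i|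
      <= B * mesh a b n ^+ j.
Proof.
move=> n0 kn Cg; have h0 := mesh_gt0 ab n0.
have B0 := Cb_ge0 ab Cg.
have gI x : 0 <= x <= 1 -> grid a b n k + x * mesh a b n \in I.
  by move=> x01; apply: piece_sub kn _ => //; apply: piece_param.
have [|c cB hc] := @taylor _ a b ab j B g (grid a b n k) Cg.
  by rewrite -[grid _ _ _ _]addr0 -(mul0r (mesh a b n)) gI // lexx ler01.
exists c => // x x01; have := hc _ (gI x x01).
rewrite gridK.
rewrite (eq_bigr (fun i : 'I_j => c i * mesh a b n ^+ i * x ^+ i)); last first.
  by move=> i _; rewrite exprMn [x ^+ i * _]mulrC mulrA.
move=> H; apply: le_trans H _; rewrite ler_wpM2l //.
have /andP[x0 x1] := x01.
rewrite normrM exprMn (gtr0_norm h0) ger0_norm // ler_piMl ?exprn_ge0 ?(ltW h0) //.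
by rewrite exprn_ile1.
Qed.

(** Interpolation is linear: on the Taylor polynomial it produces the reference errors [mono_err],
    and on the remainder it costs at most the factor [1 + Lam]. *)
Lemma interp_err_expand n k j B g : (0 < n)%N -> (k < n)%N -> Cb a b j B g ->
  exists2 c : nat -> R, forall i, `|c i| <= B & forall x, 0 <= x <= 1 ->
    `|g (grid a b n k + x * mesh a b n)
       - Qn a b q n (emb g) k (grid a b n k + x * mesh a b n)
       - \sum_(i < j) c i * mesh a b n ^+ i * (mono_err q i).[x]|
      <= (1 + Lam) * B * mesh a b n ^+ j.
Proof.
move=> n0 kn Cg; have h0 := mesh_gt0 ab n0.
have [c cB hc] := taylor_piece n0 kn Cg; exists c => // x x01.
pose rho y := g (grid a b n k + y * mesh a b n) - \sum_(i < j) c i * mesh a b n ^+ i * y ^+ i.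
have gE y : g (grid a b n k + y * mesh a b n) =
    rho y + \sum_(i < j) c i * mesh a b n ^+ i * y ^+ i by rewrite /rho subrK.
rewrite QnE // /emb /coll_node.
have -> : (grid a b n k + x * mesh a b n - grid a b n k) / mesh a b n = x.
  exact: local_coord.
have -> : g (grid a b n k + x * mesh a b n) -
    \sum_i (lag q i).[x] * g (grid a b n k + q i * mesh a b n) -
    \sum_(i < j) c i * mesh a b n ^+ i * (mono_err q i).[x] =
    rho x - \sum_i (lag q i).[x] * rho (q i).
  rewrite gE.
  have -> : \sum_i (lag q i).[x] * g (grid a b n k + q i * mesh a b n) =
    \sum_i (lag q i).[x] * rho (q i) +
    \sum_l (lag q l).[x] * \sum_(i < j) c i * mesh a b n ^+ i * q l ^+ i.
    by rewrite -big_split /=; apply: eq_bigr => i _; rewrite gE mulrDr.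
  have -> : \sum_(i < j) c i * mesh a b n ^+ i * (mono_err q i).[x] =
    \sum_(i < j) c i * mesh a b n ^+ i * x ^+ i -
    \sum_l (lag q l).[x] * \sum_(i < j) c i * mesh a b n ^+ i * q l ^+ i.
    under [X in _ = _ - X]eq_bigr => l _ do rewrite mulr_sumr.
    rewrite exchange_big -sumrB; apply: eq_bigr => i _.
    rewrite mono_errE mulrBr mulr_sumr; congr (_ - _); apply: eq_bigr => l _.
    by rewrite mulrCA.
  by ring.
have -> : (1 + Lam) * B * mesh a b n ^+ j =
  B * mesh a b n ^+ j + Lam * (B * mesh a b n ^+ j) by ring.
apply: le_trans (ler_normB _ _) _; apply: lerD; first exact: hc.
by apply: lag_sum_le => // i; apply: hc; have /andP[] := q01 i => *; rewrite !ltW.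
Qed.

Lemma interp_err n k B g t : (0 < n)%N -> (k < n)%N -> t \in piece a b n k ->
  Cb a b r B g ->
  `|g t - Qn a b q n (emb g) k t| <= (1 + Lam) * B * mesh a b n ^+ r.
Proof.
move=> n0 kn tk Cg; have [c _ hc] := interp_err_expand n0 kn Cg.
have [x x01 ->] := pieceP ab n0 tk.
have := hc x x01; rewrite [X in _ - X]big1 ?subr0 // => i _.
by rewrite mono_err_lt // horner0 mulr0.
Qed.

(* Gauss superconvergence: [G] is paired with an interpolation error at the Gauss
   points, and every product of Taylor terms of total degree less than [2 r]
   integrates to zero. *)
Lemma mean_interp_err (rho : nat) (w mu : 'I_rho -> R) (BG B : R) :
  (forall i, 0 <= mu i <= 1) -> quad_exact w mu (2 * r - 1) -> legendre_zeros q ->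
  0 <= BG -> 0 <= B ->
  exists2 C, 0 <= C & forall n p k G g, (0 < n)%N -> (0 < p)%N -> (k < n)%N ->
    mesh a b n <= 1 -> Cb a b r BG G -> Cb a b (2 * r) B g ->
    `|p%:R^-1 * \sum_(l < p) \sum_(i < rho) w i *
       (fun t => G t * (g t - Qn a b q n (emb g) k t))
         (grid a b n k + (l%:R + mu i) / p%:R * mesh a b n)|
    <= C * mesh a b n ^+ (2 * r).
Proof.
move=> hmu hex hq BG0 B0; pose W := \sum_i `|w i|.
have W0 : 0 <= W by apply: sumr_ge0.
have L0 := Lam_ge0; have L10 : 0 <= 1 + Lam by rewrite addr_ge0.
(* The three summands bound, in this order, [(Gx - TG) * E], [TG * (E - TE)] and the part of
   [TG * TE] of total degree at least [2 r]. *)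
exists (W * (BG * ((1 + Lam) * B) + BG * ((1 + Lam) * B) * r%:R +
   (r * (2 * r))%:R * (BG * B * (1 + Lam)))).
  by rewrite !(mulr_ge0, addr_ge0).
move=> n p k G g n0 p0 kn h1 CG Cg; have h0 := mesh_gt0 ab n0.
set h := mesh a b n in h1 h0 *.
have p0R : 0 < p%:R :> R by rewrite ltr0n.
have [cG cGB hG] := taylor_piece n0 kn CG.
have [cg cgB hg] := interp_err_expand n0 kn Cg.
have mean_le (Phi : R -> R) (K : R) : (forall x, 0 <= x <= 1 -> `|Phi x| <= K) ->
    `|p%:R^-1 * \sum_(l < p) \sum_(i < rho) w i * Phi ((l%:R + mu i) / p%:R)| <= W * K.
  move=> hPhi; rewrite normrM gtr0_norm ?invr_gt0 // mulrC ler_pdivrMr //.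
  apply: le_trans (ler_norm_sum _ _ _) _.
  apply: le_trans (_ : \sum_(l < p) W * K <= _); last first.
    by rewrite sumr_const card_ord mulr_natr.
  apply: ler_sum => l _; apply: le_trans (ler_norm_sum _ _ _) _.
  rewrite /W mulr_suml; apply: ler_sum => i _; rewrite normrM ler_wpM2l //.
  by apply: hPhi; apply: refined_node.
pose E x := g (grid a b n k + x * h) - Qn a b q n (emb g) k (grid a b n k + x * h).
pose Gx x := G (grid a b n k + x * h).
pose TG x := \sum_(j < r) cG j * h ^+ j * x ^+ j.
pose TE x := \sum_(i < 2 * r) cg i * h ^+ i * (mono_err q i).[x].
(* Products not kept are gathered in [Z], whose discrete mean vanishes by orthogonality. *)
pose keep (i j : nat) := (2 * r <= i + j)%N.
pose Z x := \sum_(j < r) \sum_(i < 2 * r | ~~ keep i j)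
   cG j * h ^+ j * (cg i * h ^+ i) * (x ^+ j * (mono_err q i).[x]).
pose Rst x := Gx x * E x - Z x.
have Zmean : p%:R^-1 * \sum_(l < p) \sum_(i < rho) w i * Z ((l%:R + mu i) / p%:R) = 0.
  rewrite (_ : \sum_(l < p) _ = 0) ?mulr0 //.
  transitivity (\sum_(j < r) \sum_(i < 2 * r | ~~ keep i j)
     cG j * h ^+ j * (cg i * h ^+ i) * \sum_(l < p) \sum_(c < rho) w c *
       (((l%:R + mu c) / p%:R) ^+ j * (mono_err q i).[(l%:R + mu c) / p%:R])).
    rewrite /Z.
    under eq_bigr => l _ do under eq_bigr => c _ do rewrite mulr_sumr.
    under eq_bigr => l _ do rewrite exchange_big /=.
    rewrite exchange_big /=; apply: eq_bigr => j _.
    under eq_bigr => l _ do under eq_bigr => c _ do rewrite mulr_sumr.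
    under eq_bigr => l _ do rewrite exchange_big /=.
    rewrite exchange_big /=; apply: eq_bigr => i _.
    rewrite mulr_sumr; apply: eq_bigr => l _.
    by rewrite mulr_sumr; apply: eq_bigr => c _; rewrite mulrCA.
  rewrite big1 // => j _; rewrite big1 // => i; rewrite -ltnNge => ij.
  by rewrite mono_err_orthogonal // mulr0.
have -> : p%:R^-1 * \sum_(l < p) \sum_(i < rho) w i *
       (G (grid a b n k + (l%:R + mu i) / p%:R * h) *
        (g (grid a b n k + (l%:R + mu i) / p%:R * h) -
         Qn a b q n (emb g) k (grid a b n k + (l%:R + mu i) / p%:R * h))) =
    p%:R^-1 * \sum_(l < p) \sum_(i < rho) w i * Rst ((l%:R + mu i) / p%:R).
  rewrite -[LHS]subr0 -[X in _ - X]Zmean -mulrBr -sumrB; congr (_ * _).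
  apply: eq_bigr => l _; rewrite -sumrB; apply: eq_bigr => i _.
  by rewrite -mulrBr.
rewrite -[leRHS]mulrA; apply: (mean_le Rst) => x x01; have /andP[x0 x1] := x01.
(* Here the assumption that the mesh is at most 1 lets every kept power be replaced by
   [h ^+ (2 * r)]. *)
have hr i : (2 * r <= i)%N -> h ^+ i <= h ^+ (2 * r).
  by move=> ri; apply: ler_wiXn2l => //; apply: ltW.
have mono_le i : `|(mono_err q i).[x]| <= 1 + Lam.
  rewrite mono_errE; apply: le_trans (ler_normB _ _) _; apply: lerD.
    by rewrite normrX ger0_norm // exprn_ile1.
  rewrite -[leRHS]mulr1; apply: lag_sum_le => // j.
  have /andP[/ltW qj0 /ltW qj1] := q01 j.
  by rewrite normrX ger0_norm // exprn_ile1.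
have Er : `|E x| <= (1 + Lam) * B * h ^+ r.
  apply: interp_err => //; first exact: piece_param.
  exact: (Cb_le (leq_pmull r (isT : (0 < 2)%N)) (lexx B) Cg).
have -> : Rst x = (Gx x - TG x) * E x + TG x * (E x - TE x) + (TG x * TE x - Z x).
  by rewrite /Rst; ring.
have -> : (BG * ((1 + Lam) * B) + BG * ((1 + Lam) * B) * r%:R +
   (r * (2 * r))%:R * (BG * B * (1 + Lam))) * h ^+ (2 * r) =
   BG * h ^+ r * ((1 + Lam) * B * h ^+ r) +
   r%:R * BG * ((1 + Lam) * B * h ^+ (2 * r)) +
   (r * (2 * r))%:R * (BG * B * (1 + Lam) * h ^+ (2 * r)).
  have -> : h ^+ (2 * r) = h ^+ r * h ^+ r by rewrite mul2n -addnn exprD.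
  by ring.
apply: le_trans (ler_normD _ _) _; apply: lerD.
  apply: le_trans (ler_normD _ _) _; apply: lerD; rewrite normrM ler_pM //.
  - exact: hG.
  - apply: le_trans (ler_norm_sum _ _ _) _.
    apply: le_trans (_ : \sum_(j < r) BG <= _); last by rewrite sumr_const card_ord mulr_natl.
    apply: ler_sum => j _; rewrite !normrM -[leRHS]mulr1 -[X in _ <= X * _]mulr1.
    rewrite !ler_pM ?mulr_ge0 // ?normrX.
      by rewrite gtr0_norm // exprn_ile1 // ltW.
    by rewrite ger0_norm // exprn_ile1.
  - exact: hg.
have -> : TG x * TE x - Z x = \sum_(j < r) \sum_(i < 2 * r | keep i j)
   cG j * h ^+ j * (cg i * h ^+ i) * (x ^+ j * (mono_err q i).[x]).
  rewrite /TG /TE mulr_suml -sumrB; apply: eq_bigr => j _.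
  rewrite mulr_sumr (bigID (fun i : 'I_(2 * r) => keep i j)) /= [X in _ + X - _](_ : _ =
     \sum_(i < 2 * r | ~~ keep i j)
       cG j * h ^+ j * (cg i * h ^+ i) * (x ^+ j * (mono_err q i).[x])).
    by rewrite addrK; apply: eq_bigr => i _; ring.
  by apply: eq_bigr => i _; ring.
apply: le_trans (ler_norm_sum _ _ _) _.
apply: le_trans (_ : \sum_(j < r) \sum_(i < 2 * r) BG * B * (1 + Lam) * h ^+ (2 * r) <= _).
  apply: ler_sum => j _; apply: le_trans (ler_norm_sum _ _ _) _.
  rewrite big_mkcond; apply: ler_sum => i _; case: ifPn => [ij|_]; last first.
    by rewrite !mulr_ge0 // exprn_ge0 // ltW.
  have -> : cG j * h ^+ j * (cg i * h ^+ i) * (x ^+ j * (mono_err q i).[x]) =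
    cG j * cg i * (x ^+ j * (mono_err q i).[x]) * h ^+ (i + j) by rewrite exprD; ring.
  rewrite normrM ler_pM //; last first.
    by rewrite ger0_norm ?hr // exprn_ge0 // ltW.
  rewrite normrM ler_pM // normrM ?ler_pM //.
  rewrite -[leRHS]mul1r ler_pM //.
  by rewrite normrX ger0_norm // exprn_ile1.
by rewrite !sumr_const !card_ord -mulrnA [(r * _)%N]mulnC mulr_natl.
Qed.

End Interpolation.

(** * Stability of the linearized equation *)

Section PiecewiseNorm.
Context {R : realType} (a b : R).
Hypothesis ab : a < b.

Lemma norm_E_le n (x : pwfun R) B : (0 < n)%N ->
  (forall k t, (k < n)%N -> t \in piece a b n k -> `|x k t| <= B) ->
  norm_E a b n x <= B.
Proof.
move=> n0 hB; apply: ge_sup.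
  exists `|x 0 (grid a b n 0)|, 0, (grid a b n 0); split => //.
  by rewrite in_itv /= lexx grid_le.
by move=> _ [k [t [kn tk ->]]]; apply: hB.
Qed.

(** The value of [B] does not matter: its existence guarantees that [sup] is a genuine supremum. *)
Lemma norm_E_ge n (x : pwfun R) B k t :
  (forall k t, (k < n)%N -> t \in piece a b n k -> `|x k t| <= B) ->
  (k < n)%N -> t \in piece a b n k -> `|x k t| <= norm_E a b n x.
Proof.
move=> hB kn tk; apply: ub_le_sup; last by exists k, t.
by exists B => _ [k' [t' [kn' tk' ->]]]; apply: hB.
Qed.

Lemma in_E_bounded n (x : pwfun R) : in_E a b n x -> exists B,
  forall k t, (k < n)%N -> t \in piece a b n k -> `|x k t| <= B.
Proof.
move=> xE; suff [B hB] : exists B, forall k, (k < n)%N -> forall t,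
    t \in piece a b n k -> `|x k t| <= B by exists B => k t kn; apply: hB.
have : forall k, (k < n)%N -> exists B, forall t, t \in piece a b n k -> `|x k t| <= B.
  by move=> k kn; apply: within_bounded (xE k kn).
elim: n (piece a b n) {xE} => [|n IH] P h; first by exists 0.
have [|B1 hB1] := IH P; first by move=> k kn; apply: h; apply: ltnW.
have [B2 hB2] := h n (ltnSn n).
exists (Num.max B1 B2) => k; rewrite ltnS leq_eqVlt => /orP[/eqP ->|kn] t tP.
  by rewrite le_max hB2 ?orbT.
by rewrite le_max hB1.
Qed.

Lemma in_E_sub n (x : pwfun R) (g : R -> R) : in_E a b n x ->
  {within [set` `[a, b]], continuous g} -> in_E a b n (fun k t => x k t - g t).
Proof.
move=> xE cg k kn; apply: within_continuousB; first exact: xE.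
apply: continuous_subspaceW cg => t /=; exact: piece_sub.
Qed.

End PiecewiseNorm.

(** * The interpolation error as a normalized combination of evaluations *)

Section PointEvaluations.
Context {R : realType} (a b : R).
Hypothesis ab : a < b.
Local Notation I := `[a, b].
Implicit Type F : R -> R -> R -> R.

Lemma feval_is_derive (S : seq (R * R)) F t : has_partial_u a b F ->
  (forall c, c \in S -> c.2 \in I) -> t \in I ->
  forall u : R, is_derive u 1 (feval S F t) (feval S (partial_u F) t u).
Proof.
move=> hF SI tI u; rewrite /feval; elim: S SI => [|c S IH] SI.
  rewrite big_nil (_ : (fun _ => _) = cst 0); last by apply/funext => v; rewrite big_nil.
  exact: is_derive_cst.
rewrite big_cons (_ : (fun _ => _) = (c.1 \*: F c.2 t) + fun v => \sum_(p <- S) p.1 * F p.2 t v).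
  apply: is_deriveD; first apply: is_deriveZ.
    by apply: (@partial_u_is_derive _ a b) => //; apply: SI; rewrite mem_head.
  by apply: IH => c' c'S; apply: SI; rewrite in_cons c'S orbT.
by apply/funext => v; rewrite big_cons.
Qed.

Lemma dint_feval rho (w mu : 'I_rho -> R) (n p : nat) (S : seq (R * R)) F (x : pwfun R) :
  dint a b w mu n p (fun k t => feval S F t (x k t)) =
  \sum_(c <- S) c.1 * nystrom a b w mu F n p x c.2.
Proof.
elim: S => [|c S IH].
  rewrite big_nil /dint big1 ?mulr0 // => j _; rewrite big1 // => i _.
  by rewrite /feval big_nil mulr0.
rewrite big_cons -IH -[nystrom _ _ _ _ _ _ _ _ _]/(dint a b w mu n p (fun k t => F c.2 t (x k t))).
rewrite dintZ dintD /dint; congr (_ * _); apply: eq_bigr => j _; apply: eq_bigr => i _.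
by rewrite /feval big_cons.
Qed.

Variables (r : nat) (q : 'I_r -> R).
Hypothesis q_inj : injective q.
Hypothesis q01 : forall i, 0 < q i < 1.

(* Evaluation of [mesh ^- r * (g - Q_n g)] at the point [s] of the [k]-th piece. *)
Definition interp_pts (n k : nat) (s : R) : seq (R * R) :=
  (mesh a b n ^- r, s) :: [seq (- (mesh a b n ^- r * (lag q i).[(s - grid a b n k) / mesh a b n]),
    coll_node a b q n k i) | i <- enum 'I_r].

Lemma interp_ptsE n k s (g : R -> R) : (0 < n)%N ->
  \sum_(c <- interp_pts n k s) c.1 * g c.2 =
  mesh a b n ^- r * (g s - Qn a b q n (emb g) k s).
Proof.
move=> n0; rewrite QnE // big_cons big_map big_enum /= mulrBr; congr (_ + _).
rewrite mulr_sumr -sumrN; apply: eq_bigr => i _.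
by rewrite /emb mulNr mulrA.
Qed.

Lemma interp_pts_in n k s : (0 < n)%N -> (k < n)%N -> s \in piece a b n k ->
  forall c, c \in interp_pts n k s -> c.2 \in I.
Proof.
move=> n0 kn sk c; rewrite in_cons => /orP[/eqP -> /=|/mapP[i _ ->] /=].
  exact: piece_sub sk.
by apply: piece_sub kn _ => //; apply: coll_node_piece.
Qed.

Definition all_interp_pts : set (seq (R * R)) :=
  [set S | exists n k s, [/\ (0 < n)%N, (k < n)%N, s \in piece a b n k & S = interp_pts n k s]].

Lemma all_interp_pts_in S : all_interp_pts S -> forall c, c \in S -> c.2 \in I.
Proof. by move=> [n [k [s [n0 kn sk ->]]]]; apply: interp_pts_in. Qed.

(** The weight [h^-r] cancels the [h^r] of [interp_err] applied to the slice in [s], so the bound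
    depends neither on [n] nor on the piece. *)
Lemma interp_pts_bounded F : C_Omega a b r F -> forall M : R, exists B : R,
  forall S t u, all_interp_pts S -> t \in I -> `|u| <= M -> `|feval S F t u| <= B.
Proof.
move=> CF M; have [B hB] := C_Omega_slice M CF.
exists ((1 + Lam q) * B) => _ t u [n [k [s [n0 kn sk ->]]]] tI uM.
have h0 : 0 < mesh a b n ^+ r by rewrite exprn_gt0 // mesh_gt0.
rewrite /feval (interp_ptsE k s (fun s => F s t u)) //.
rewrite normrM normfV (gtr0_norm h0) mulrC ler_pdivrMr //.
exact: interp_err (hB t u tI uM).
Qed.

End PointEvaluations.

(** * Uniform invertibility of the linearized discrete equation *)

Section Stability.
Context {R : realType} (a b : R).
Hypothesis ab : a < b.
Local Notation I := `[a, b].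
Variables (rho : nat) (w mu : 'I_rho -> R).
Hypothesis hmu : forall i, 0 <= mu i <= 1.
Hypothesis w1 : \sum_i w i = 1.

(** The linearized operator is thus itself of Urysohn type, with zero right-hand side, and falls
    under [nystrom_compactness]. *)
Lemma continuous_linearized (F : R -> R -> R -> R) (phi : R -> R) :
  continuous_Omega a b F -> {within [set` I], continuous phi} ->
  continuous_Omega a b (fun s t u => F s t (phi t) * u).
Proof.
move=> cF cphi.
have cG : continuous_Omega a b (fun s t _ => F s t (phi t)).
  apply/continuous_OmegaE => s t u sI tI e e0.
  have [d d0 hd] := continuous_OmegaP cF (phi t) sI tI e0.
  have /within_continuousP /(_ t tI d d0)[d' d'0 hd'] := cphi.
  exists (Num.min d d'); first by rewrite lt_min d0.
  move=> s' t' u' s'I t'I; rewrite !lt_min => /andP[h1 _] /andP[h2 h3] _.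
  by apply: hd => //; rewrite distrC; apply: hd'.
have cu : continuous_Omega a b (fun _ _ u => u).
  by apply/continuous_OmegaE => s t u sI tI e e0; exists e => // *; rewrite distrC.
move=> z; apply: (@continuousM R (subspace (Omega a b))); [exact: cG|exact: cu].
Qed.

(* If the bound failed, normalized counterexamples would accumulate at an
   eigenfunction for the eigenvalue 1. *)
Lemma stability (F : R -> R -> R -> R) (phi : R -> R) :
  continuous_Omega a b F -> {within [set` I], continuous phi} ->
  ~ eigenvalue_Linfty a b (fun v s => \int[lebesgue_measure]_(t in [set` I])
      (F s t (phi t) * v t)) 1 ->
  exists N : nat, forall n p (v : pwfun R) eta B, (N <= n)%N -> (0 < n)%N -> (0 < p)%N ->
    (forall k t, (k < n)%N -> t \in piece a b n k -> `|v k t| <= B) ->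
    (forall k s, (k < n)%N -> s \in piece a b n k ->
      `|v k s - dint a b w mu n p (fun k t => F s t (phi t) * v k t)| <= eta) ->
    norm_E a b n v <= N%:R * eta.
Proof.
move=> cF cphi hev; apply: contrapT => /forallNP H.
have {}H (j : nat) : exists z : nat * nat * pwfun R * R,
    [/\ (j < z.1.1.1)%N, (0 < z.1.1.2)%N,
     (exists B, forall k t, (k < z.1.1.1)%N -> t \in piece a b z.1.1.1 k -> `|z.1.2 k t| <= B),
     (forall k s, (k < z.1.1.1)%N -> s \in piece a b z.1.1.1 k ->
       `|z.1.2 k s - dint a b w mu z.1.1.1 z.1.1.2 (fun k t => F s t (phi t) * z.1.2 k t)| <= z.2) &
     j.+1%:R * z.2 < norm_E a b z.1.1.1 z.1.2].
  (* The same integer is threshold and constant: failure at [j + 1] gives both [j < n] and a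
     residual bound smaller than the norm divided by [j + 1]. *)
  apply: contrapT => Hj; apply: (H j.+1) => n p v eta B jn n0 p0 hB hv.
  rewrite leNgt; apply/negP => lt; apply: Hj; exists (n, p, v, eta); split => //.
  by exists B.
have [z hz] := choice H.
pose n j := (z j).1.1.1; pose p j := (z j).1.1.2; pose v j := (z j).1.2.
pose eta j := (z j).2; pose E j := norm_E a b (n j) (v j).
have n0 j : (0 < n j)%N by have [h _ _ _ _] := hz j; apply: leq_ltn_trans h.
have eta_ge0 j : 0 <= eta j.
  have [_ _ _ h _] := hz j; apply: le_trans (h 0 (grid a b (n j) 0) (n0 j) _) => //.
  by rewrite in_itv /= lexx grid_le.
have E0 j : 0 < E j.
  by have [_ _ _ _ h] := hz j; apply: le_lt_trans h; rewrite mulr_ge0 // eta_ge0.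
have vE j k t : (k < n j)%N -> t \in piece a b (n j) k -> `|v j k t| <= E j.
  by have [_ _ [B hB] _ _] := hz j; apply: norm_E_ge hB.
pose kk s t u := F s t (phi t) * u.
pose x j k t := v j k t / E j.
have ckk : continuous_Omega a b kk by apply: continuous_linearized.
have c0 : {within [set` I], continuous (fun _ : R => 0 : R)}.
  by apply: continuous_subspaceT => t; apply: cvg_cst.
have [|||||X [cX hX near]] := @nystrom_compactness R a b ab rho w mu hmu w1 kk (fun=> 0)
  n p x 1 (fun j => j.+1%:R^-1) ckk c0.
- by move=> j; have [] := hz j.
- by move=> j; have [] := hz j.
- move=> j k t kn tk; rewrite /x normrM normfV (gtr0_norm (E0 j)).
  by rewrite ler_pdivrMr // mul1r vE.
- move=> j k t kn tk; have [_ _ _ /(_ k t kn tk) h hE] := hz j.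
  rewrite -[nystrom _ _ _ _ _ _ _ _ _]/(dint a b w mu (n j) (p j) (fun k t' => kk t t' (x j k t'))).
  have -> : dint a b w mu (n j) (p j) (fun k t' => kk t t' (x j k t')) =
     (E j)^-1 * dint a b w mu (n j) (p j) (fun k t' => F t t' (phi t') * v j k t').
    rewrite dintZ /dint; congr (_ * _); apply: eq_bigr => l _; apply: eq_bigr => i _.
    by congr (_ * _); rewrite /kk /x; ring.
  rewrite subr0 /x [v j k t / _]mulrC -mulrBr normrM normfV (gtr0_norm (E0 j)).
  rewrite mulrC ler_pdivrMr // [_ * E j]mulrC ler_pdivlMr ?ltr0n //.
  by apply: le_trans (ltW hE); rewrite mulrC ler_wpM2l.
- move=> e e0; exists (Num.bound e^-1) => j hj.
  rewrite invf_ple ?posrE ?ltr0n //; apply: le_trans (ltW (archi_boundP _)) _.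
    by rewrite invr_ge0 ltW.
  by rewrite ler_nat ltnW.
apply: hev; exists X; split.
- exact: Linfty_continuous.
- move=> X0; have {}X0 := ae_itv_eq ab cX c0 X0.
  (* With [X = 0], some normalized [x j] is at most [1 / 4] everywhere, while [v j] takes a value
     above half of its norm. *)
  have [|j _ hj] := near 4^-1 _ 0; first by rewrite invr_gt0.
  have [||_ [k [t [kn tk ->]]] ltE] := @sup_gt R [set c | exists k t,
     [/\ (k < n j)%N, t \in piece a b (n j) k & c = `|v j k t|]] (E j / 2).
  + exists `|v j 0 (grid a b (n j) 0)|, 0, (grid a b (n j) 0); split => //.
    by rewrite in_itv /= lexx grid_le.
  + by rewrite -[X in _ < X]/(E j); have := E0 j; lra.
  + have := hj k t kn tk; rewrite (X0 t (piece_sub ab kn tk)) subr0 /x.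
    rewrite normrM normfV (gtr0_norm (E0 j)) ler_pdivrMr //; move: ltE; have := E0 j; lra.
- apply: aeW => s sI; rewrite mul1r.
  by rewrite [RHS](hX s sI) add0r.
Qed.

End Stability.

(** * The error estimate *)

Section ErrorEstimate.
Context {R : realType} (a b : R).
Hypothesis ab : a < b.
Local Notation I := `[a, b].
Variables (r rho : nat) (w mu : 'I_rho -> R) (q : 'I_r -> R).
Hypothesis hr : (1 <= r)%N.
Hypothesis hmu : forall i, 0 <= mu i <= 1.
Hypothesis hexact : quad_exact w mu (2 * r - 1).
Hypothesis hq : legendre_zeros q.
Variables (kappa : R -> R -> R -> R) (f phi : R -> R).

Local Notation N n p x := (nystrom a b w mu kappa n p x).

Lemma legendre_zeros_inj : injective q.
Proof.
have [_ qlt _] := hq; move=> i j qij; apply/val_inj.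
by have [/qlt|/qlt|//] := ltngtP i j; rewrite qij ltxx.
Qed.

Lemma weights_sum : \sum_i w i = 1.
Proof.
have := @quad_exact_primitive _ _ w mu _ 'X hexact.
rewrite derivX size_poly1 !hornerE subr0 => /(_ isT) <-.
by apply: eq_bigr => i _; rewrite !hornerE.
Qed.

Lemma residual_identity n p z k s : (0 < n)%N -> (k < n)%N -> s \in piece a b n k ->
  dmp_eq a b w mu q kappa f n p z ->
  z k s - f s - N n p z s = mesh a b n ^+ r *
    (dint a b w mu n p (fun k' t => feval (interp_pts a b q n k s) kappa t (Qn a b q n z k' t)) -
     dint a b w mu n p (fun k' t => feval (interp_pts a b q n k s) kappa t (z k' t))).
Proof.
move=> n0 kn sk /(_ k kn s sk).
have [q01 _ _] := hq; have q_inj := legendre_zeros_inj.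
rewrite !dint_feval.
rewrite (interp_ptsE ab q_inj k s (fun s => N n p (Qn a b q n z) s)) //.
rewrite (interp_ptsE ab q_inj k s (fun s => N n p z s)) //.
have h0 : mesh a b n ^+ r != 0 by rewrite expf_neq0 // gt_eqF // mesh_gt0.
rewrite -mulrBr mulrA divff // mul1r /dmp /emb => <-.
move: (Qn _ _ _ _ _ _ _) (Qn _ _ _ _ _ _ _) (N _ _ _ _) (N _ _ _ _) => u1 u2 u3 u4.
by ring.
Qed.

(** The outer error contributes [h^r], and the bracket of [residual_identity] is [O(h^(2 r) + E)].
    The bound [M0] on [z] is needed because the kernel is controlled only for bounded [u]. *)
Lemma residual_estimate (M0 Bphi : R) : 0 <= M0 ->
  has_partial_u a b kappa -> C_Omega a b (2 * r) (partial_u kappa) ->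
  Cb a b (2 * r) Bphi phi ->
  exists2 C, 0 <= C & forall n p z E, (0 < n)%N -> (0 < p)%N -> mesh a b n <= 1 ->
    dmp_eq a b w mu q kappa f n p z ->
    (forall k t, (k < n)%N -> t \in piece a b n k -> `|z k t| <= M0) ->
    (forall k t, (k < n)%N -> t \in piece a b n k -> `|z k t - phi t| <= E) ->
    forall k s, (k < n)%N -> s \in piece a b n k ->
      `|z k s - f s - N n p z s| <= C * (mesh a b n ^+ (3 * r) + mesh a b n ^+ r * E).
Proof.
move=> M00 hu Cu Cphi; have [q01 _ _] := hq; have q_inj := legendre_zeros_inj.
have Bphi0 := Cb_ge0 ab Cphi; have L0 := Lam_ge0 q.
have ba0 : 0 <= b - a by rewrite subr_ge0 ltW.
pose W := \sum_i `|w i|; have W0 : 0 <= W by apply: sumr_ge0.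
(* One range containing the values of [z], [phi] and both of their interpolants. *)
pose M := (1 + Lam q) * (M0 + Bphi).
have M0M : M0 <= M by rewrite /M; nra.
have BphiM : Bphi <= M by rewrite /M; nra.
have LM0M : Lam q * M0 <= M by rewrite /M; nra.
have LBphiM : Lam q * Bphi <= M by rewrite /M; nra.
have r2 : (2 * r = (2 * r).-1.+1)%N by lia.
have [huu Cuu] : has_partial_u a b (partial_u kappa) /\
    C_Omega a b r (partial_u (partial_u kappa)).
  move: Cu; rewrite r2 => -[_ [[_ _ huu] [_ _ Cuu]]]; split => //.
  by apply: C_Omega_le Cuu; lia.
have Cur : C_Omega a b r (partial_u kappa) by apply: C_Omega_le Cu; rewrite leq_pmull.
have Cphir : Cb a b r Bphi phi := Cb_le (leq_pmull r (isT : (0 < 2)%N)) (lexx _) Cphi.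
have [Bu Bu0 hBu] : exists2 Bu, 0 <= Bu & forall S t u, all_interp_pts a b q S ->
    t \in I -> `|u| <= M -> `|feval S (partial_u kappa) t u| <= Bu.
  have [B hB] := interp_pts_bounded ab q_inj q01 Cur M.
  by exists (Num.max 0 B) => [|S t u VS tI uM]; rewrite le_max ?lexx // hB ?orbT.
have [Buu Buu0 hBuu] : exists2 B, 0 <= B & forall S t u, all_interp_pts a b q S ->
    t \in I -> `|u| <= M -> `|feval S (partial_u (partial_u kappa)) t u| <= B.
  have [B hB] := interp_pts_bounded ab q_inj q01 Cuu M.
  by exists (Num.max 0 B) => [|S t u VS tI uM]; rewrite le_max ?lexx // hB ?orbT.
(* Of the [2 r] derivatives of [partial_u kappa], [r] are used by the interpolation in [s], and the
   other [r] make this coefficient of class [r] in [t]. *)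
have [BG BG0 hBG] : exists2 B, 0 <= B & forall S, all_interp_pts a b q S ->
    Cb a b r B (fun t => feval S (partial_u kappa) t (phi t)).
  have Curr : C_Omega a b (r + r) (partial_u kappa) by rewrite addnn -mul2n.
  have [B hB] := feval_Cb ab (all_interp_pts_in ab q01)
    (interp_pts_bounded ab q_inj q01) Curr Cphir.
  exists (Num.max 0 B) => [|S VS]; first by rewrite le_max lexx.
  by apply: Cb_le (hB S VS); rewrite // le_max lexx orbT.
have [Cm Cm0 hCm] := mean_interp_err ab q_inj q01 hmu hexact hq BG0 Bphi0.
pose C := (b - a) * W * (Bu * (1 + Lam q)) +
  ((b - a) * W * (Buu * ((1 + Lam q) * Bphi) ^+ 2) + (b - a) * Cm).
have C0 : 0 <= C.
  by rewrite /C; move: (b - a) ba0 => d d0; rewrite !(addr_ge0, mulr_ge0, exprn_ge0).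
exists C => // n p z E n0 p0 h1 hz zM zE k s kn sk.
have h0 := mesh_gt0 ab n0; set h := mesh a b n in h0 h1 *.
have E0 : 0 <= E by apply: le_trans (zE k s kn sk).
rewrite residual_identity // -/h.
set S := interp_pts a b q n k s.
have VS : all_interp_pts a b q S by exists n, k, s.
have SI := all_interp_pts_in ab q01 VS.
have df t := @feval_is_derive R a b S kappa t hu SI.
have df' t := @feval_is_derive R a b S (partial_u kappa) t huu SI.
have phiM k' t : (k' < n)%N -> t \in piece a b n k' -> `|phi t| <= Bphi.
  by move=> kn' tk; apply: Cb_bound Cphi _ (piece_sub ab kn' tk).
pose Qz := Qn a b q n z; pose Qp := Qn a b q n (emb phi).
have QzM k' t : (k' < n)%N -> t \in piece a b n k' -> `|Qz k' t| <= M.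
  move=> kn' tk; apply: le_trans LM0M.
  by apply: Qn_le => // t' tk'; apply: zM.
have QpM k' t : (k' < n)%N -> t \in piece a b n k' -> `|Qp k' t| <= M.
  move=> kn' tk; apply: le_trans LBphiM.
  by apply: Qn_le => // t' tk'; apply: phiM tk'.
have lip t u v : t \in I -> `|u| <= M -> `|v| <= M ->
    `|feval S kappa t v - feval S kappa t u| <= Bu * `|v - u|.
  move=> tI uM vM; have [c [_ cM ->]] := line_MVT (df t tI) u v.
  rewrite normrM ler_wpM2r // hBu //; apply: le_trans cM _.
  by rewrite ge_max uM.
(* [T1] is the cost of replacing [z] by [phi], of order [E]; [T2] is the second-order remainder in
   [u], of order [(h^r)^2]; [T3] is the linear term, of order [h^(2 r)] by [mean_interp_err]. *)
pose T1 := dint a b w mu n p (fun k' t => (feval S kappa t (Qz k' t) - feval S kappa t (Qp k' t))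
   - (feval S kappa t (z k' t) - feval S kappa t (phi t))).
pose T2 := dint a b w mu n p (fun k' t => feval S kappa t (Qp k' t) - feval S kappa t (phi t)
   - feval S (partial_u kappa) t (phi t) * (Qp k' t - phi t)).
pose T3 := dint a b w mu n p (fun k' t =>
   feval S (partial_u kappa) t (phi t) * (phi t - Qp k' t)).
have -> : dint a b w mu n p (fun k' t => feval S kappa t (Qz k' t)) -
   dint a b w mu n p (fun k' t => feval S kappa t (z k' t)) = T1 + T2 - T3.
  rewrite /T1 /T2 /T3 dintD !dintB; congr (dint a b w mu n p).
  by apply/funext => k'; apply/funext => t; ring.
have hT1 : `|T1| <= (b - a) * W * (Bu * (1 + Lam q) * E).
  apply: dint_le => // k' t kn' tk; have tI := piece_sub ab kn' tk.
  have -> : Bu * (1 + Lam q) * E = Bu * (Lam q * E) + Bu * E by ring.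
  apply: le_trans (ler_normB _ _) _; apply: lerD.
    apply: le_trans (lip _ _ _ tI (QpM _ _ kn' tk) (QzM _ _ kn' tk)) _.
    rewrite ler_wpM2l // /Qz /Qp QnB //; apply: Qn_le => // t' tk'.
    exact: zE.
  apply: le_trans (lip _ _ _ tI _ _) _.
  - exact: le_trans (phiM _ _ kn' tk) BphiM.
  - exact: le_trans (zM _ _ kn' tk) M0M.
  - by rewrite ler_wpM2l // zE.
have hT2 : `|T2| <= (b - a) * W * (Buu * ((1 + Lam q) * Bphi * h ^+ r) ^+ 2).
  apply: dint_le => // k' t kn' tk; have tI := piece_sub ab kn' tk.
  apply: le_trans (line_taylor2 (df t tI) (df' t tI) (fun u => hBuu S t u VS tI) _ _) _.
  - exact: le_trans (phiM _ _ kn' tk) BphiM.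
  - exact: QpM.
  - rewrite ler_wpM2l // lerXn2r ?nnegrE ?mulr_ge0 ?addr_ge0 ?exprn_ge0 ?(ltW h0) //.
    by rewrite distrC; apply: interp_err.
have hT3 : `|T3| <= (b - a) * Cm * h ^+ (2 * r).
  rewrite /T3 dint_pieces // -(meshE a b n0) -/h.
  apply: le_trans (ler_norm_sum _ _ _) _.
  apply: le_trans (_ : \sum_(k' < n) h * (Cm * h ^+ (2 * r)) <= _); last first.
    by rewrite sumr_const card_ord -[leLHS]mulr_natl !mulrA.
  apply: ler_sum => k' _; rewrite normrM (gtr0_norm h0) ler_wpM2l ?(ltW h0) //.
  exact: (hCm n p k' _ _ n0 p0 (ltn_ord k') h1 (hBG S VS) Cphi).
rewrite normrM ger0_norm ?exprn_ge0 ?(ltW h0) //.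
have -> : C * (h ^+ (3 * r) + h ^+ r * E) = h ^+ r * (C * (h ^+ (2 * r) + E)).
  by rewrite (mulSn 2 r) exprD -mulrDr mulrCA.
rewrite ler_wpM2l ?exprn_ge0 ?(ltW h0) //.
apply: le_trans (ler_normB _ _) _.
apply: le_trans (lerD (le_trans (ler_normD _ _) (lerD hT1 hT2)) hT3) _.
have h2r : (h ^+ r) ^+ 2 = h ^+ (2 * r) by rewrite -exprM mulnC.
rewrite exprMn h2r; have h2r0 : 0 <= h ^+ (2 * r) by rewrite exprn_ge0 ?(ltW h0).
pose c1 := (b - a) * W * (Bu * (1 + Lam q)).
pose c2 := (b - a) * W * (Buu * ((1 + Lam q) * Bphi) ^+ 2).
pose c3 := (b - a) * Cm.
have c10 : 0 <= c1 by rewrite /c1; move: (b - a) ba0 => y y0; rewrite !(mulr_ge0, addr_ge0).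
have c20 : 0 <= c2.
  by rewrite /c2; move: (b - a) ba0 => y y0; rewrite !(mulr_ge0, addr_ge0, exprn_ge0).
have c30 : 0 <= c3 by rewrite /c3 mulr_ge0.
move: (h ^+ (2 * r)) h2r0 => H H0.
apply: le_trans (_ : c1 * E + c2 * H + c3 * H <= _); first by rewrite /c1 /c2 /c3 !mulrA.
rewrite -[C]/(c1 + (c2 + c3)).
have := mulr_ge0 c10 H0; have := mulr_ge0 c20 E0; have := mulr_ge0 c30 E0.
clear -R; move: c1 c2 c3 => c1 c2 c3; lra.
Qed.

(** The integral operator smooths: derivatives in [s] fall on the kernel, so continuity of [phi] is
    enough for its image to be of class [d], and the equation passes this on to [phi]. *)
Lemma urysohn_smooth d : C_Omega a b d kappa -> C_itv a b d f ->
  urysohn_unique a b kappa f phi ->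
  {in I, forall s, phi s = f s + urysohn a b kappa phi s} /\ C_itv a b d phi.
Proof.
move=> Ck Cf [cphi [_ sol] _].
have CK : C_itv a b d (urysohn a b kappa phi) by apply: C_itv_integral.
have Cs := C_itvD ab Cf CK.
have E : {in I, phi =1 fun s => f s + urysohn a b kappa phi s}.
  apply: ae_itv_eq => //; first by case: (d) Cs => [|d'] [].
  have [B [mB B0 sB]] := sol; exists B; split => // s hs; apply: sB => h.
  by apply: hs => /h /eqP; rewrite subr_eq => /eqP.
split; first exact: E.
by apply: C_itv_ext Cs => // s sI; rewrite E.
Qed.

(** The assumed quadrature bound is applied to [t |-> kappa s t (phi t)]; the point is a bound on
    its [d]-th derivative that is uniform in [s]. *)
Lemma quadrature_error d C1 :
  (forall (m : nat) (g : R -> R), (0 < m)%N -> C_itv a b d g ->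
     `| \int[lebesgue_measure]_(t in `[a, b]) g t - composite w mu a b m g |
       <= C1 * supnorm_itv a b (derive_itv a b d g) * mesh a b m ^+ d) ->
  C_Omega a b d kappa -> C_itv a b d phi ->
  exists2 C, 0 <= C & forall n p s, (0 < n)%N -> (0 < p)%N -> s \in I ->
    `|urysohn a b kappa phi s - N n p (emb phi) s| <= C * mesh a b (n * p) ^+ d.
Proof.
move=> hcomp Ck /(C_itv_Cb)[Bphi Cphi].
(* Single evaluations with weight 1 form a family to which [feval_Cb] applies with [r = 0]. *)
pose V := [set S : seq (R * R) | exists2 s, s \in I & S = [:: (1, s)]].
have [||B hB] := @feval_Cb R a b ab V 0 _ _ d kappa phi Bphi Ck Cphi.
- by move=> _ [s sI ->] c; rewrite inE => /eqP ->.
- move=> F CF M; have [B hB] := Omega_bounded (C_Omega_continuous CF) M.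
  by exists B => _ t u [s sI ->] tI uM; rewrite /feval big_seq1 mul1r hB.
exists (`|C1| * `|B|) => [|n p s n0 p0 sI]; first by rewrite mulr_ge0.
have np0 : (0 < n * p)%N by rewrite muln_gt0 n0.
have Cg : Cb a b d B (fun t => kappa s t (phi t)).
  apply: Cb_ext (hB [:: (1, s)] _); last by exists s.
  by move=> t _; rewrite /feval big_seq1 mul1r.
apply: le_trans (hcomp (n * p)%N _ np0 (Cb_C_itv ab Cg)) _.
rewrite ler_wpM2r ?exprn_ge0 ?(ltW (mesh_gt0 ab np0)) //.
apply: le_trans (ler_norm _) _; rewrite normrM ler_wpM2l //.
have sup_le : supnorm_itv a b (derive_itv a b d (fun t => kappa s t (phi t))) <= B.
  apply: ge_sup; first by exists `|derive_itv a b d (fun t => kappa s t (phi t)) a|;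
    exists a => //; apply: left_in_itv.
  by move=> _ [t tI <-]; apply: (Cb_derive_itv ab Cg).
have sup_ge0 : 0 <= supnorm_itv a b (derive_itv a b d (fun t => kappa s t (phi t))).
  apply: le_trans (ub_le_sup _ _); last by exists a => //; apply: left_in_itv.
    exact: normr_ge0.
  by exists B => _ [t tI <-]; apply: (Cb_derive_itv ab Cg).
by rewrite ger0_norm //; apply: le_trans sup_le (ler_norm _).
Qed.

Lemma mesh_pow_small (C e : R) : 0 < e -> 0 <= C -> exists N0, forall n, (N0 <= n)%N ->
  (0 < n)%N -> mesh a b n <= 1 /\ C * mesh a b n ^+ r <= e.
Proof.
move=> e0 C0; have ba0 : 0 < b - a by rewrite subr_gt0.
exists (Num.bound (b - a) + Num.bound (C * (b - a) / e))%N => n hn n0.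
have n0R : 0 < n%:R :> R by rewrite ltr0n.
have h0 := mesh_gt0 ab n0.
have h1 : mesh a b n <= 1.
  rewrite /mesh ler_pdivrMr // mul1r; apply: le_trans (ltW (archi_boundP (ltW ba0))) _.
  by rewrite ler_nat; apply: leq_trans (leq_addr _ _) hn.
split=> //; apply: le_trans (_ : C * mesh a b n <= _).
  rewrite ler_wpM2l //; case: (r) hr => // r' _.
  by rewrite exprS ler_piMr ?(ltW h0) // exprn_ile1 // ltW.
rewrite /mesh mulrA ler_pdivrMr // [e * _]mulrC -ler_pdivrMr //.
apply: le_trans (ltW (archi_boundP _)) _.
  by rewrite divr_ge0 ?mulr_ge0 // ltW.
by rewrite ler_nat; apply: leq_trans (leq_addl _ _) hn.
Qed.

Lemma ball_E_dist n delta z k t : {within [set` I], continuous phi} ->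
  ball_E a b n phi delta z -> (k < n)%N -> t \in piece a b n k ->
  `|z k t - phi t| <= delta.
Proof.
move=> cphi [zE zd] kn tk; apply: le_trans zd.
have [B hB] := in_E_bounded (in_E_sub ab zE cphi).
exact: (norm_E_ge hB).
Qed.

(** A convergence without rate, whose role is to make the quadratic term of the final inequality
    absorbable. *)
Lemma consistency delta : 0 < delta ->
  has_partial_u a b kappa -> C_Omega a b (2 * r) (partial_u kappa) ->
  continuous_Omega a b kappa -> {within [set` I], continuous f} ->
  C_itv a b (2 * r) phi -> urysohn_unique a b kappa f phi ->
  forall e : R, 0 < e -> exists N0, forall n p z, (N0 <= n)%N -> (0 < n)%N -> (0 < p)%N ->
    ball_E a b n phi delta z -> dmp_eq a b w mu q kappa f n p z ->
    norm_E a b n (fun k t => z k t - phi t) <= e.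
Proof.
move=> delta0 hu Cu ck cf /(C_itv_Cb)[Bphi Cphi] huniq e e0.
have cphi := Cb_continuous Cphi; have Bphi0 := Cb_ge0 ab Cphi.
have M00 : 0 <= Bphi + delta by rewrite addr_ge0 // ltW.
have [C C0 hC] := residual_estimate M00 hu Cu Cphi.
apply: contrapT => /forallNP H.
have {}H (j : nat) : exists y : nat * nat * pwfun R, [/\ (j < y.1.1)%N, (0 < y.1.2)%N,
    mesh a b y.1.1 <= 1, ball_E a b y.1.1 phi delta y.2 /\
    dmp_eq a b w mu q kappa f y.1.1 y.1.2 y.2
    & exists k t, [/\ (k < y.1.1)%N, t \in piece a b y.1.1 k & e < `|y.2 k t - phi t|]].
  apply: contrapT => Hj.
  (* Used with the constant 0, only to obtain a mesh at most 1. *)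
  have [N1 hN1] := mesh_pow_small ltr01 (lexx 0).
  apply: (H (maxn j.+1 N1)) => n p z; rewrite geq_max => /andP[jn N1n] n0 p0 hb hz.
  rewrite leNgt; apply/negP => lt; apply: Hj; exists (n, p, z); split=> //=.
    by have [] := hN1 n N1n n0.
  apply: contrapT => nex; move: lt; rewrite ltNge => /negP; apply.
  apply: norm_E_le => // k t kn tk; rewrite leNgt; apply/negP => lt.
  by apply: nex; exists k, t.
have [y hy] := choice H.
have y0 j : (0 < (y j).1.1)%N by have [h _ _ _ _] := hy j; apply: leq_ltn_trans h.
have yd j k t : (k < (y j).1.1)%N -> t \in piece a b (y j).1.1 k ->
    `|(y j).2 k t - phi t| <= delta.
  by have [_ _ _ [hb _] _] := hy j; apply: ball_E_dist.
have yM j k t : (k < (y j).1.1)%N -> t \in piece a b (y j).1.1 k ->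
    `|(y j).2 k t| <= Bphi + delta.
  move=> kn tk; rewrite -[(y j).2 k t](subrK (phi t)) addrC.
  apply: le_trans (ler_normD _ _) (lerD _ (yd _ _ _ kn tk)).
  exact: Cb_bound Cphi _ (piece_sub ab kn tk).
have [|||||X [cX hX near]] := @nystrom_compactness R a b ab rho w mu hmu weights_sum
  kappa f (fun j => (y j).1.1) (fun j => (y j).1.2) (fun j => (y j).2) (Bphi + delta)
  (fun j => C * (1 + delta) * mesh a b (y j).1.1 ^+ r) ck cf.
- by move=> j; have [] := hy j.
- by move=> j; have [] := hy j.
- by move=> j k t; apply: yM.
(* Membership in the ball gives the crude error bound [delta]; with [h^(3 r) <= h^r], the residual
   is already [O(h^r)]. *)
- move=> j k t kn tk; have [_ p0 m1 [_ hz] _] := hy j.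
  apply: le_trans (hC _ _ _ delta (y0 j) p0 m1 hz (yM j) (yd j) k t kn tk) _.
  rewrite -mulrA ler_wpM2l // mulrDl mul1r [delta * _]mulrC lerD2r.
  by apply: ler_wiXn2l => //; [rewrite ltW ?mesh_gt0|rewrite leq_pmull].
- move=> e' e'0; have CC0 : 0 <= C * (1 + delta) by rewrite mulr_ge0 // addr_ge0 // ltW.
  have [N1 hN1] := mesh_pow_small e'0 CC0; exists N1 => j hj.
  have [jy _ _ _ _] := hy j.
  by have [] := hN1 _ (leq_trans hj (ltnW jy)) (y0 j).
have [_ _ uniq] := huniq.
have XP : {in I, X =1 phi}.
  apply: (ae_itv_eq ab cX cphi); apply: uniq; split; first exact: Linfty_continuous.
  by apply: aeW => s sI; rewrite (hX s sI) /urysohn addrK.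
have [j _ hj] := near _ e0 0.
have [_ _ _ _ [k [t [kn tk]]]] := hy j.
by rewrite ltNge -XP ?hj // (piece_sub ab kn tk).
Qed.

End ErrorEstimate.

(** * The final inequality and its constants *)

Unset Implicit Arguments.

Theorem theorem4p7 (R : realType) (a b : R) (hab : a < b)
  (r : nat) (hr : (1 <= r)%N)
  (rho : nat) (w mu : 'I_rho -> R)
  (hmu : forall i, 0 <= mu i <= 1)
  (hexact : quad_exact w mu (2 * r - 1))
  (d : nat) (hd : (2 * r <= d)%N) (C1 : R)
  (hcomposite : forall (m : nat) (g : R -> R), (0 < m)%N -> C_itv a b d g ->
     `| \int[lebesgue_measure]_(t in `[a, b]) g t - composite w mu a b m g |
       <= C1 * supnorm_itv a b (derive_itv a b d g) * mesh a b m ^+ d)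
  (q : 'I_r -> R) (hq : legendre_zeros q)
  (kappa : R -> R -> R -> R)
  (hkappa_cont : continuous_Omega a b kappa)
  (hkappa_u : has_partial_u a b kappa)
  (hkappa_uu : has_partial_u a b (partial_u kappa))
  (hkappa_uu_cont : continuous_Omega a b (partial_u (partial_u kappa)))
  (hkappa : C_Omega a b d kappa)
  (hdkappa : C_Omega a b (2 * r) (partial_u kappa))
  (f : R -> R) (hf : C_itv a b d f)
  (phi : R -> R) (hphi : urysohn_unique a b kappa f phi)
  (heig : ~ eigenvalue_Linfty a b (urysohn_deriv a b kappa phi) 1)
  (delta0 : R) (n1 m1 : nat)
  (hstd : standing_constants a b w mu q kappa f phi delta0 n1 m1) :
  exists C : R, forall (n p : nat) (z : pwfun R),
    (n1 <= n)%N -> (1 <= p)%N -> (m1 <= n * p)%N ->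
    unique_in_ball a b n phi delta0 (dmp_eq a b w mu q kappa f n p) z ->
    norm_E a b n (fun k t => z k t - phi t)
      <= C * Num.max (mesh a b (n * p) ^+ d) (mesh a b n ^+ (3 * r)).
Proof.
have [q01 _ _] := hq; have q_inj := legendre_zeros_inj hq.
have w1 := weights_sum hexact.
have ba0 : 0 <= b - a by rewrite subr_ge0 ltW.
have [d0 n10 _ _] := hstd.
have [phiE Cphid] := urysohn_smooth hab hkappa hf hphi.
have cf : {within [set` `[a, b]], continuous f}.
  by have [B /Cb_continuous] := C_itv_Cb hf.
have [Bd Cbd] := C_itv_Cb Cphid.
have Cphi2 : C_itv a b (2 * r) phi := Cb_C_itv hab (Cb_le hd (lexx _) Cbd).
have [Bphi Cphi] := C_itv_Cb Cphi2.
have cphi := Cb_continuous Cphi; have Bphi0 := Cb_ge0 hab Cphi.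
have M00 : 0 <= Bphi + delta0 by rewrite addr_ge0 // ltW.
have [Cr Cr0 hCr] := residual_estimate hab hr hmu hexact hq f M00 hkappa_u hdkappa Cphi.
have [Cq Cq0 hCq] := quadrature_error hab hcomposite hkappa Cphid.
have [B hB] := Omega_bounded hkappa_uu_cont (Bphi + delta0).
pose W := \sum_i `|w i|; have W0 : 0 <= W by apply: sumr_ge0.
pose Ct := (b - a) * W * Num.max 0 B.
have Ct0 : 0 <= Ct by rewrite !mulr_ge0 // le_max lexx.
have [Ns hNs] := stability hab hmu w1 (C_Omega_continuous hdkappa) cphi heig.
have SS0 : 0 < Ns%:R * Ct + 1 by rewrite ltr_wpDl // mulr_ge0.
(* This threshold for the error makes [Ns * Ct * E] at most [1 / 4]; the added 1 keeps the divisor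
   positive. *)
have e0 : 0 < (4 * (Ns%:R * Ct + 1))^-1 by rewrite invr_gt0 mulr_gt0.
have [Nc hNc] := consistency hab hr hmu hexact hq d0 hkappa_u hdkappa hkappa_cont cf Cphi2 hphi e0.
have q40 : 0 < 4^-1 :> R by rewrite invr_gt0.
have NCr0 : 0 <= Ns%:R * Cr by rewrite mulr_ge0.
(* Beyond [Nm], the coefficient [Ns * Cr * h^r] of the linear error term is at most [1 / 4] as
   well. *)
have [Nm hNm] := mesh_pow_small hab hr q40 NCr0.
pose N0 := maxn 1 (maxn Ns (maxn Nc Nm)).
have N00 : (0 < N0)%N by rewrite /N0 leq_max.
pose h0 := mesh a b N0; have h00 : 0 < h0 by apply: mesh_gt0.
(* The first summand serves for [n > N0]. The second serves for [n <= N0], where the mesh is at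
   least [h0] and the error at most [delta0]. *)
exists (2 * Ns%:R * (Cr + Cq) + delta0 / h0 ^+ (3 * r)) => n p z hn hp hm [hball hz _].
have n0 : (0 < n)%N by apply: leq_trans hn.
have np0 : (0 < n * p)%N by rewrite muln_gt0 n0.
set E := norm_E a b n _; set mx := Num.max _ _.
have hpow0 : 0 <= mesh a b n ^+ (3 * r) by rewrite exprn_ge0 // ltW // mesh_gt0.
have mx1 : mesh a b (n * p) ^+ d <= mx by rewrite le_max lexx.
have mx2 : mesh a b n ^+ (3 * r) <= mx by rewrite le_max lexx orbT.
have mx0 : 0 <= mx by apply: le_trans mx2.
have K0 : 0 <= delta0 / h0 ^+ (3 * r) by rewrite divr_ge0 ?exprn_ge0 // ltW.
have K1 : 0 <= 2 * Ns%:R * (Cr + Cq) by rewrite !mulr_ge0 // addr_ge0.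
have Ed : E <= delta0 by case: hball.
rewrite mulrDl; have [nN|Nn] := leqP n N0.
  apply: le_trans (_ : delta0 / h0 ^+ (3 * r) * mx <= _); last first.
    by rewrite lerDr mulr_ge0.
  apply: le_trans Ed _; rewrite -mulrA ler_peMr ?(ltW d0) //.
  rewrite mulrC ler_pdivlMr ?exprn_gt0 // mul1r; apply: le_trans mx2.
  rewrite lerXn2r ?nnegrE ?(ltW h00) ?(ltW (mesh_gt0 _ _)) //.
  by rewrite /h0 /mesh ler_wpM2l // lef_pV2 ?posrE ?ltr0n // ler_nat.
apply: le_trans (_ : 2 * Ns%:R * (Cr + Cq) * mx <= _); last by rewrite lerDl mulr_ge0.
have Nsn : (Ns <= n)%N by apply: leq_trans (ltnW Nn); rewrite /N0 !leq_max leqnn orbT.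
have Ncn : (Nc <= n)%N by apply: leq_trans (ltnW Nn); rewrite /N0 !leq_max leqnn !orbT.
have Nmn : (Nm <= n)%N by apply: leq_trans (ltnW Nn); rewrite /N0 !leq_max leqnn !orbT.
have [h1 hr4] := hNm n Nmn n0.
have Ee : E <= (4 * (Ns%:R * Ct + 1))^-1 := hNc n p z Ncn n0 hp hball hz.
have zd k t : (k < n)%N -> t \in piece a b n k -> `|z k t - phi t| <= delta0.
  exact: ball_E_dist.
have zE k t : (k < n)%N -> t \in piece a b n k -> `|z k t - phi t| <= E.
  exact: (norm_E_ge zd).
have phiM t : t \in `[a, b] -> `|phi t| <= Bphi + delta0.
  by move=> tI; apply: le_trans (Cb_bound Cphi tI) _; rewrite lerDl ltW.
have zM k t : (k < n)%N -> t \in piece a b n k -> `|z k t| <= Bphi + delta0.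
  move=> kn tk; rewrite -[z k t](subrK (phi t)) addrC.
  apply: le_trans (ler_normD _ _) (lerD _ (zd _ _ kn tk)).
  exact: Cb_bound Cphi _ (piece_sub hab kn tk).
have E0 : 0 <= E.
  apply: le_trans (zE 0 (grid a b n 0) n0 _) => //.
  by rewrite in_itv /= lexx grid_le.
pose eta := Cr * (mesh a b n ^+ (3 * r) + mesh a b n ^+ r * E) + Ct * E ^+ 2 +
  Cq * mesh a b (n * p) ^+ d.
have key : E <= Ns%:R * eta.
  apply: (hNs n p _ eta delta0) => // k s kn sk.
  have sI := piece_sub hab kn sk.
  have e1 := hCr n p z E n0 hp h1 hz zM zE k s kn sk.
  have e2 := hCq n p s n0 hp sI.
  pose T := dint a b w mu n p (fun k t => kappa s t (z k t) - kappa s t (phi t) -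
    partial_u kappa s t (phi t) * (z k t - phi t)).
  have e3 : `|T| <= Ct * E ^+ 2.
    rewrite /Ct -mulrA; apply: dint_le => // k' t kn' tk.
    have tI := piece_sub hab kn' tk.
    have hB' u : `|u| <= Bphi + delta0 -> `|partial_u (partial_u kappa) s t u| <= Num.max 0 B.
      by move=> uM; rewrite le_max hB ?orbT.
    apply: le_trans (line_taylor2 (partial_u_is_derive hkappa_u sI tI)
      (partial_u_is_derive hkappa_uu sI tI) hB' (phiM t tI) (zM _ _ kn' tk)) _.
    rewrite ler_wpM2l ?le_max ?lexx // lerXn2r ?nnegrE //; exact: zE.
  (* The linearized residual of the error is the residual of [z], plus the Taylor remainder [T] of
     the kernel in [u], plus the quadrature error at [phi]. *)
  have -> : z k s - phi s - dint a b w mu n p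
       (fun k t => partial_u kappa s t (phi t) * (z k t - phi t)) =
     (z k s - f s - nystrom a b w mu kappa n p z s) + T +
     (nystrom a b w mu kappa n p (emb phi) s - urysohn a b kappa phi s).
    have -> : T = nystrom a b w mu kappa n p z s - nystrom a b w mu kappa n p (emb phi) s -
       dint a b w mu n p (fun k t => partial_u kappa s t (phi t) * (z k t - phi t)).
      rewrite -[nystrom _ _ _ _ _ _ _ z _]/(dint a b w mu n p (fun k t => kappa s t (z k t))).
      rewrite -[nystrom _ _ _ _ _ _ _ _ _]/(dint a b w mu n p (fun k t => kappa s t (phi t))).
      by rewrite !dintB.
    by rewrite {1}(phiE s sI); ring.
  apply: le_trans (ler_normD _ _) (lerD (le_trans (ler_normD _ _) (lerD e1 e3)) _).
  by rewrite distrC.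
have quadE : Ns%:R * (Ct * E ^+ 2) <= 4^-1 * E.
  have -> : Ns%:R * (Ct * E ^+ 2) = Ns%:R * Ct * E * E.
    by rewrite expr2 [LHS]mulrA [LHS]mulrA.
  rewrite ler_wpM2r //.
  apply: le_trans (_ : (Ns%:R * Ct + 1) * (4 * (Ns%:R * Ct + 1))^-1 <= _).
    by apply: ler_pM => //; [rewrite mulr_ge0|rewrite lerDl].
  by rewrite invfM mulrCA divff ?mulr1 // gt_eqF.
have linE : Ns%:R * (Cr * (mesh a b n ^+ r * E)) <= 4^-1 * E by rewrite !mulrA ler_wpM2r.
have smooth3 : Ns%:R * (Cr * mesh a b n ^+ (3 * r)) <= Ns%:R * (Cr * mx).
  by rewrite !ler_wpM2l.
have smoothd : Ns%:R * (Cq * mesh a b (n * p) ^+ d) <= Ns%:R * (Cq * mx).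
  by rewrite !ler_wpM2l.
have {}key : E <= Ns%:R * (Cr * mesh a b n ^+ (3 * r)) +
  Ns%:R * (Cr * (mesh a b n ^+ r * E)) + Ns%:R * (Ct * E ^+ 2) +
  Ns%:R * (Cq * mesh a b (n * p) ^+ d).
  by apply: le_trans key _; rewrite /eta !mulrDr.
have -> : 2 * Ns%:R * (Cr + Cq) * mx = 2 * (Ns%:R * (Cr * mx) + Ns%:R * (Cq * mx)) by ring.
(* The two terms in [E] take at most half of the left-hand side, whence the factor 2 in the
   constant. *)
lra.
Qed.
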